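(* The honest characters and supercharacters of the N=3 modules $H(\Lambda^{[-1,0]})$ and $H(\Lambda^{[-1,2]})$ (the case $m=2$) are, for $(\tau,z)\in\mathbb{C}_+\times\mathbb{C}$: 1) (i) ${\rm ch}^{(+)}_{H(\Lambda^{[-1,0]})}(\tau,z)=-\frac12\Big\{\frac{\eta(\frac\tau2)}{\eta(2\tau)\eta(\tau)}\vartheta_{01}(\tau,z)+\frac{1}{\eta(\frac\tau2)\eta(2\tau)}\vartheta_{00}(\tau,z)\Big\}$; (ii) ${\rm ch}^{(+)}_{H(\Lambda^{[-1,2]})}(\tau,z)=-\frac12\Big\{\frac{\eta(\frac\tau2)}{\eta(2\tau)\eta(\tau)}\vartheta_{01}(\tau,z)-\frac{1}{\eta(\frac\tau2)\eta(2\tau)}\vartheta_{00}(\tau,z)\Big\}$; 2) (i) ${\rm ch}^{(-)}_{H(\Lambda^{[-1,0]})}(\tau,z)=-\frac i2\Big\{\frac{\eta(\tau)^2}{\eta(\frac\tau2)\eta(2\tau)^2}\vartheta_{00}(\tau,z)+\frac{\eta(\frac\tau2)}{\eta(\tau)^3}\vartheta_{01}(\tau,z)\Big\}$; (ii) ${\rm ch}^{(-)}_{H(\Lambda^{[-1,2]})}(\tau,z)=-\frac i2\Big\{\frac{\eta(\tau)^2}{\eta(\frac\tau2)\eta(2\tau)^2}\vartheta_{00}(\tau,z)-\frac{\eta(\frac\tau2)}{\eta(\tau)^3}\vartheta_{01}(\tau,z)\Big\}$.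
   Context: Notation: $\mathbb{C}_+$ is the upper half-plane, $q^a:=e^{2\pi i a\tau}$, $\eta(\tau)=q^{1/24}\prod_{n\ge1}(1-q^n)$, and for $a,b\in\{0,1\}$ the Mumford theta functions are $\vartheta_{ab}(\tau,z)=\sum_{n\in\mathbb{Z}}e^{\pi i\tau(n+\frac a2)^2+2\pi i(n+\frac a2)(z+\frac b2)}$. For $m\in\frac12\mathbb{N}$, $s\in\frac12\mathbb{Z}$ put $\Phi_1^{[m,s]}(\tau,z_1,z_2,t)=e^{-2\pi imt}\sum_{j\in\mathbb{Z}}\frac{e^{2\pi imj(z_1+z_2)+2\pi isz_1}e^{2\pi i\tau(mj^2+sj)}}{1-e^{2\pi iz_1}e^{2\pi ij\tau}}$, $\Phi_2^{[m,s]}(\tau,z_1,z_2,t)=e^{-2\pi imt}\sum_{j\in\mathbb{Z}}\frac{e^{-2\pi imj(z_1+z_2)-2\pi isz_2}e^{2\pi i\tau(mj^2+sj)}}{1-e^{-2\pi iz_2}e^{2\pi ij\tau}}$, $\Phi^{[m,s]}=\Phi_1^{[m,s]}-\Phi_2^{[m,s]}$. N=3 denominators: $R^{(+)}(\tau,z)=\eta(\frac\tau2)\eta(2\tau)\frac{\vartheta_{11}(\tau,z)}{\vartheta_{00}(\tau,z)}$, $R^{(-)}(\tau,z)=\frac{\eta(\tau)^3}{\eta(\frac\tau2)}\frac{\vartheta_{11}(\tau,z)}{\vartheta_{01}(\tau,z)}$. For $m_2\in\{0,1,2\}$ let $H(\Lambda^{[-1,m_2]})$ be the N=3 superconformal module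 obtained by quantum Hamiltonian reduction of the $\widehat{osp}(3|2)$-module of highest weight $\Lambda^{[-1,m_2]}=-\Lambda_0-\frac{m_2}{2}\alpha_1$. Its (honest) character and supercharacter are the functions of $(\tau,z)$ given by $R^{(+)}{\rm ch}^{(+)}_{H(\Lambda^{[-1,m_2]})}=\Phi^{[1,\frac{m_2+1}2]}(2\tau,z+\frac\tau2-\frac12,z-\frac\tau2+\frac12,\frac\tau8)$ and $R^{(-)}{\rm ch}^{(-)}_{H(\Lambda^{[-1,m_2]})}=\Phi^{[1,\frac{m_2+1}2]}(2\tau,z+\frac\tau2,z-\frac\tau2,\frac\tau8)$. *)

(* Defs.v *)
From mathcomp Require Import all_boot all_order all_algebra.
From mathcomp Require Import complex.
From mathcomp Require Import all_classical all_reals all_analysis.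

Set Implicit Arguments.
Unset Strict Implicit.
Unset Printing Implicit Defensive.

Import Order.TTheory GRing.Theory Num.Theory.
Import numFieldNormedType.Exports.

Local Open Scope classical_set_scope.
Local Open Scope ring_scope.
Local Open Scope complex_scope.

(* The complex numbers, as the structure from which MathComp-Analysis derives
   the topology. *)
Definition Cplx (R : realType) : numClosedFieldType := R[i].

Section N3Characters.
Variable R : realType.
Local Notation C := (Cplx R).

Definition cexp (z : C) : C :=
  (expR (complex.Re z))%:C * (cos (complex.Im z) +i* sin (complex.Im z)).

(* [e2pi x] is e^{2 pi i x}; thus q^a is [e2pi (a * tau)]. *)
Definition e2pi (x : C) : C := cexp (2 * ((pi : R)%:C : C) * 'i * x).

(* Sum over all integers: both one-sided series are summed separately, so this
   is the usual value for (absolutely) convergent two-sided series. *)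
Definition sumZ (f : int -> C) : C :=
  limn (series (fun k : nat => f k%:Z)) +
  limn (series (fun k : nat => f (- (k.+1)%:Z))).

Definition eta (tau : C) : C :=
  e2pi (tau / 24) *
  limn (fun N : nat => \prod_(1 <= n < N.+1) (1 - e2pi (n%:R * tau))).

(* Mumford theta functions; the indices are meant to be 0 or 1. Note that
   e^{pi i x} is [e2pi (x / 2)]. *)
Definition theta (a b : nat) (tau z : C) : C :=
  sumZ (fun n : int =>
    e2pi (tau * (n%:~R + a%:R / 2) ^+ 2 / 2
          + (n%:~R + a%:R / 2) * (z + b%:R / 2))).

(* As [x / 0 = 0], the values of [Phi1] and [Phi2] are only meaningful where
   none of the denominators vanishes. *)
Definition Phi1 (m s tau z1 z2 t : C) : C :=
  e2pi (- m * t) *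
  sumZ (fun j : int =>
    e2pi (m * j%:~R * (z1 + z2) + s * z1)
    * e2pi (tau * (m * j%:~R ^+ 2 + s * j%:~R))
    / (1 - e2pi z1 * e2pi (j%:~R * tau))).

Definition Phi2 (m s tau z1 z2 t : C) : C :=
  e2pi (- m * t) *
  sumZ (fun j : int =>
    e2pi (- m * j%:~R * (z1 + z2) - s * z2)
    * e2pi (tau * (m * j%:~R ^+ 2 + s * j%:~R))
    / (1 - e2pi (- z2) * e2pi (j%:~R * tau))).

Definition Phi (m s tau z1 z2 t : C) : C :=
  Phi1 m s tau z1 z2 t - Phi2 m s tau z1 z2 t.

Definition Rplus (tau z : C) : C :=
  eta (tau / 2) * eta (2 * tau) * (theta 1 1 tau z / theta 0 0 tau z).

Definition Rminus (tau z : C) : C :=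
  eta tau ^+ 3 / eta (tau / 2) * (theta 1 1 tau z / theta 0 1 tau z).

(* The (super)character of H(Lambda^{[-1,m2]}), 0 <= m2 <= 2, is the function
   determined by R ch = Phi. This is an identity of meromorphic functions of z:
   R vanishes on Z + tau Z and both sides have poles at the zeros of theta 0 0
   (resp. theta 0 1). These points are isolated, so the value of the quotient
   Phi / R at z is its limit along the punctured neighbourhoods of z, on which
   R is finite and nonzero and Phi is finite. *)
Definition ch_plus (m2 : nat) (tau z : C) : C :=
  lim (Phi 1 ((m2%:R + 1) / 2) (2 * tau)
         (w + tau / 2 - 1 / 2) (w - tau / 2 + 1 / 2) (tau / 8)
       / Rplus tau w @[w --> z^']).

Definition ch_minus (m2 : nat) (tau z : C) : C :=
  lim (Phi 1 ((m2%:R + 1) / 2) (2 * tau)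
         (w + tau / 2) (w - tau / 2) (tau / 8)
       / Rminus tau w @[w --> z^']).

End N3Characters.

(* Main.v *)
Require Import Defs.
From mathcomp Require Import all_boot all_order all_algebra.
From mathcomp Require Import complex.
From mathcomp Require Import all_classical all_reals all_analysis.
From mathcomp Require Import ring lra zify.

(* Write q = e^(2 pi i tau), x = e^(2 pi i z), th q y = sum_n y^n q^(n(n-1)/2),
   and let p be the square root of q given by p = q^(1/2) for the characters and
   p = - q^(1/2) for the supercharacters. Up to an elementary factor, the
   difference of the numerators Phi for m2 = 0 and m2 = 2 is th q (- x q), that is
   theta_11, while their sum is
     sum_k x^k q^(k(k+1)/2) (1 - x p q^k) / (1 + x p q^k).
   Multiply this sum by th q (x p). By quasi-periodicity the theta function
   cancels the pole of each summand, which becomes a value of the entire series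
   L(y) = th q y / (1 + y). Exchanging the resulting absolutely convergent double
   sum shows that the product is a constant multiple of th p (- x p), and the
   triple product factors the latter into th q (- x p) th q (- x q). The constant
   is found at x = - 1 / p, where only k = 0 contributes, from Jacobi's identity
   sum_n n (-1)^n q^(n(n-1)/2) = - prod_n (1 - q^n)^3. *)

Set Implicit Arguments.
Unset Strict Implicit.
Unset Printing Implicit Defensive.

Import Order.TTheory GRing.Theory Num.Theory.
Import numFieldNormedType.Exports.

Local Open Scope classical_set_scope.
Local Open Scope ring_scope.
Local Open Scope complex_scope.

(** * Two-sided series of complex numbers *)

(** Both kinds of characters are instances of z1 = z + u, z2 = z - u with e^(4 pi i u) = q and p = -
    e^(2 pi i u), so everything before the eta quotients is done once, for a general such p. The
    modulus 2 tau makes Phi1 run over the even and Phi2 over the odd indices of one series;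
    combining m2 = 0 with m2 = 2 reassembles that series, and in the difference the two halves of
    each fraction add up to a term without a pole. After the exchange of sums the inner sum could
    depend on the outer index N. It does so only through (-1)^N, because the Laurent coefficients of
    (1 - y) L(y) change sign under n -> 1 - n while n(n-1)/2 is invariant; hence a single unknown
    constant remains. No series is differentiated: Jacobi's identity comes from a recurrence for
    finite sums, and L(-1), which is the derivative of the theta function at -1, from a summation by
    parts. As the characters are punctured limits, the identities are needed only where no
    denominator vanishes, and continuity of the theta functions gives the values at the remaining
    points. *)

Section ComplexNorm.
Variable R : realType.
Local Notation C := (Cplx R).

(** The norm of [C] takes its values in [C], whose order is only partial; a real-valued modulus
    makes estimates accessible to real arithmetic. *)
Definition nm (x : C) : R := Normc.normc x.
Arguments nm : simpl never.

Lemma normE (x : C) : `|x| = (nm x)%:C.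
Proof. by case: x => a b. Qed.

Lemma nm0 : nm 0 = 0. Proof. exact: Normc.normc0. Qed.
Lemma nm1 : nm 1 = 1. Proof. exact: Normc.normc1. Qed.
Lemma nmM x y : nm (x * y) = nm x * nm y.
Proof. exact: Normc.normcM. Qed.
Lemma nmV x : nm x^-1 = (nm x)^-1.
Proof. exact: Normc.normcV. Qed.
Lemma nmD x y : nm (x + y) <= nm x + nm y.
Proof. exact: le_normcD. Qed.
Lemma nmN x : nm (- x) = nm x.
Proof. exact: normcN. Qed.
Lemma nm_ge0 x : 0 <= nm x.
Proof. by case: x => a b; exact: sqrtr_ge0. Qed.
Lemma nm_eq0 x : (nm x == 0) = (x == 0).
Proof.
apply/eqP/eqP => [|->]; last exact: nm0.
exact: Normc.eq0_normc.
Qed.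
Lemma nm_gt0 x : (0 < nm x) = (x != 0).
Proof. by rewrite lt_neqAle nm_ge0 andbT eq_sym nm_eq0. Qed.
Lemma nmX x n : nm (x ^+ n) = nm x ^+ n.
Proof. by elim: n => [|n IH]; rewrite ?expr0 ?nm1// !exprS nmM IH. Qed.
Lemma nmXz x (n : int) : nm (x ^ n) = nm x ^ n.
Proof.
by case: n => n; rewrite ?NegzE -?exprnP ?nmX // -!exprnN nmV nmX.
Qed.
Lemma nmB x y : nm (x - y) = nm (y - x).
Proof. by rewrite -nmN opprB. Qed.
Lemma nm_nat (n : nat) : nm (n%:R : C) = n%:R.
Proof. by apply: (@complexI R); rewrite -normE normr_nat rmorph_nat. Qed.

Lemma nm_int (k : int) : nm (k%:~R : C) = `|k|%N%:R.
Proof. by case: k => n; rewrite ?NegzE ?mulrNz ?nmN ?abszN -pmulrn nm_nat. Qed.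

(** An exponential bound in [k] is what the Gaussian estimates below can absorb; this puts the
    weight of Jacobi's identity in that form. *)
Lemma nm_sign_int (k : int) : nm (k%:~R * (- 1) ^ k : C) <= 2 ^+ `|k|%N.
Proof.
rewrite nmM nmXz nmN nm1 exp1rz mulr1 nm_int.
by rewrite -natrX ler_nat ltnW// ltn_expl.
Qed.

Lemma nm_Re (x : C) : `|complex.Re x| <= nm x.
Proof.
case: x => a b; rewrite /nm /= -sqrtr_sqr ler_wsqrtr//.
by rewrite lerDl sqr_ge0.
Qed.
Lemma nm_Im (x : C) : `|complex.Im x| <= nm x.
Proof.
case: x => a b; rewrite /nm /= -sqrtr_sqr ler_wsqrtr//.
by rewrite lerDr sqr_ge0.
Qed.
Lemma nm_le (x : C) : nm x <= `|complex.Re x| + `|complex.Im x|.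
Proof.
case: x => a b; rewrite /nm /= -[leRHS]ger0_norm ?addr_ge0//.
rewrite -sqrtr_sqr ler_wsqrtr// sqrrD !real_normK ?num_real//.
by rewrite -addrAC lerDl mulrn_wge0// mulr_ge0.
Qed.

Lemma cvg_nm {T} {F : set_system T} {FF : Filter F} (f : T -> C) (l : C) :
  (forall e : R, 0 < e -> \forall x \near F, nm (f x - l) <= e) ->
  f x @[x --> F] --> l.
Proof.
move=> H; apply/cvgrPdist_le => e e0.
have [e1 e1E] : exists e1 : R, e = e1%:C.
  by apply/complex_realP; exact: gtr0_real.
move: e0; rewrite e1E ltcR => e10.
near=> x.
rewrite normE lecR nmB; near: x; exact: H.
Unshelve. all: by end_near. Qed.

Lemma nm_cvg {T} {F : set_system T} {FF : Filter F} (f : T -> C) (l : C) :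
  f x @[x --> F] --> l ->
  forall e : R, 0 < e -> \forall x \near F, nm (f x - l) <= e.
Proof.
move=> /cvgrPdist_le H e e0.
have /H : (0 : C) < e%:C by rewrite ltcR.
by apply: filterS => x; rewrite normE lecR nmB.
Qed.

(* The complex numbers carry no completeness instance: one passes through the
   real and imaginary parts. *)
Lemma cvgn_series_geom (u : nat -> C) (A r : R) : 0 <= r < 1 ->
  (forall k, nm (u k) <= A * r ^+ k) -> cvgn (series u).
Proof.
move=> /andP[r0 r1] H.
have cv (h : C -> R) : (forall x, `|h x| <= nm x) -> cvgn (series (h \o u)).
  move=> hn; apply: normed_cvg.
  apply: (@series_le_cvg _ _ (geometric A r)).
  - by move=> n; exact: normr_ge0.
  - by move=> n; exact: le_trans (normr_ge0 _) (le_trans (hn _) (H n)).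
  - by move=> n; exact: le_trans (hn _) (H n).
  - by apply: is_cvg_geometric_series; rewrite ger0_norm.
have cR := cv _ nm_Re; have cI := cv _ nm_Im.
pose l : C := limn (series (@complex.Re R \o u)) +i* limn (series (@complex.Im R \o u)).
apply/cvg_ex; exists l.
apply: cvg_nm => e e0.
have e20 : 0 < e / 2 by lra.
move/cvgrPdist_le: cR => /(_ _ e20) HR.
move/cvgrPdist_le: cI => /(_ _ e20) HI.
have sR n : complex.Re (series u n) = series (@complex.Re R \o u) n.
  rewrite !seriesEord /=; elim: n => [|n IH]; rewrite ?big_ord0// !big_ord_recr /= -IH.
  by case: (\sum_(i < n) _) (u n) => a b [].
have sI n : complex.Im (series u n) = series (@complex.Im R \o u) n.
  rewrite !seriesEord /=; elim: n => [|n IH]; rewrite ?big_ord0// !big_ord_recr /= -IH.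
  by case: (\sum_(i < n) _) (u n) => a b [].
near=> n.
apply: le_trans (nm_le _) _.
have -> : e = e / 2 + e / 2 by lra.
apply: lerD.
- have -> : complex.Re (series u n - l) = series (@complex.Re R \o u) n - limn (series (@complex.Re R \o u)).
    by rewrite -sR; case: (series u n).
  by rewrite distrC; near: n.
- have -> : complex.Im (series u n - l) = series (@complex.Im R \o u) n - limn (series (@complex.Im R \o u)).
    by rewrite -sI; case: (series u n).
  by rewrite distrC; near: n.
Unshelve. all: by end_near. Qed.

End ComplexNorm.
Arguments nm : simpl never.

(** * Geometrically dominated series over the integers *)

Section TwoSidedSums.
Variable R : realType.
Local Notation C := (Cplx R).
Implicit Types (f g : int -> C) (A r : R).

(** All series here decay like a Gaussian, so geometric domination is enough as a notion of
    summability; it is stable under shifts, reflections and passage to a parity class, and it gives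
    explicit tail bounds. *)
Definition gdom f A r :=
  [/\ 0 < r, r < 1 & forall k : int, nm (f k) <= A * r ^+ `|k|%N].

Definition zsummable f := exists A r, gdom f A r.

(** The window is - n <= k < n, in accordance with the way [sumZ] splits the integers. Through
    [sumZ_unique], identities between sums become limits of identities between windows. *)
Definition psum f (n : nat) : C :=
  \sum_(k < n) f k%:Z + \sum_(k < n) f (- (k.+1)%:Z).

Lemma psumS f n : psum f n.+1 = psum f n + (f n%:Z + f (- (n.+1)%:Z)).
Proof. by rewrite /psum !big_ord_recr /= addrACA. Qed.

Lemma gdom_ge0 f A r : gdom f A r -> 0 <= A.
Proof. by case=> _ _ /(_ 0); rewrite expr0 mulr1; exact: le_trans (nm_ge0 _). Qed.

Lemma psum_cvg f : zsummable f -> psum f n @[n --> \oo] --> sumZ f.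
Proof.
move=> [A [r df]]; have A0 := gdom_ge0 df; case: df => r0 r1 df.
have E n : psum f n =
  series (fun k : nat => f k%:Z) n + series (fun k : nat => f (- (k.+1)%:Z)) n.
  by rewrite !seriesEord.
under eq_fun do rewrite E.
have c1 : cvgn (series (fun k : nat => f k%:Z)).
  by apply: (@cvgn_series_geom _ _ A r) => [|k]; [rewrite ltW|exact: df].
have c2 : cvgn (series (fun k : nat => f (- (k.+1)%:Z))).
  apply: (@cvgn_series_geom _ _ A r) => [|k]; first by rewrite ltW.
  apply: le_trans (df _) _.
  by rewrite abszN ler_wpM2l//= exprS ler_piMl ?exprn_ge0 ?ltW.
exact: cvgD c1 c2.
Qed.

Lemma sumZ_unique f s : zsummable f -> psum f n @[n --> \oo] --> s -> sumZ f = s.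
Proof. by move=> /psum_cvg sf cs; exact: norm_cvg_unique sf cs. Qed.

Lemma nm_psum_sub f A r n m : gdom f A r ->
  nm (psum f (n + m) - psum f n) <= 2 * A * r ^+ n * (1 - r ^+ m) / (1 - r).
Proof.
move=> df; have A0 := gdom_ge0 df; case: df => r0 r1 df.
have r1' : 0 < 1 - r by rewrite subr_gt0.
elim: m => [|m IH].
  by rewrite addn0 !subrr nm0 mulr0 mul0r.
rewrite addnS psumS addrAC.
apply: le_trans (nmD _ _) _.
have -> : 2 * A * r ^+ n * (1 - r ^+ m.+1) / (1 - r) =
  2 * A * r ^+ n * (1 - r ^+ m) / (1 - r) + 2 * A * r ^+ (n + m).
  by rewrite exprS exprD; field; lra.
apply: lerD => //; apply: le_trans (nmD _ _) _.
have := df (n + m)%N; have := df (- ((n + m).+1)%:Z).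
rewrite abszN /= => h1 h2.
have h3 : A * r ^+ (n + m).+1 <= A * r ^+ (n + m).
  by rewrite ler_wpM2l// exprS ler_piMl ?exprn_ge0 ?ltW.
lra.
Qed.

Lemma psum_tail f A r n : gdom f A r ->
  nm (sumZ f - psum f n) <= 2 * A * r ^+ n / (1 - r).
Proof.
move=> df; have A0 := gdom_ge0 df.
have sf : zsummable f by exists A, r.
have [r0 r1 _] := df.
have r1' : 0 < 1 - r by rewrite subr_gt0.
apply/ler_addgt0Pr => e e0.
have [N _ HN] := nm_cvg (psum_cvg sf) e0.
have := HN (n + N)%N (leq_addl _ _) => /= hN.
have -> : sumZ f - psum f n = - (psum f (n + N) - sumZ f) + (psum f (n + N) - psum f n).
  by ring.
apply: le_trans (nmD _ _) _; rewrite nmN addrC lerD//.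
apply: le_trans (nm_psum_sub _ _ df) _.
rewrite ler_pM2r ?invr_gt0//.
by rewrite ler_piMr ?mulr_ge0 ?exprn_ge0 ?(ltW r0)// gerBl exprn_ge0// ltW.
Qed.

Lemma nm_psum f A r n : gdom f A r -> nm (psum f n) <= 2 * A / (1 - r).
Proof.
move=> df; have A0 := gdom_ge0 df; have [r0 r1 _] := df.
have r1' : 0 < 1 - r by rewrite subr_gt0.
have := nm_psum_sub 0 n df.
rewrite add0n {2}/psum !big_ord0 addr0 subr0 expr0 mulr1 => /le_trans; apply.
rewrite ler_pM2r ?invr_gt0//.
by rewrite ler_piMr ?mulr_ge0 // gerBl exprn_ge0// ltW.
Qed.

Lemma nm_sumZ f A r : gdom f A r -> nm (sumZ f) <= 2 * A / (1 - r).
Proof.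
move=> df; have := psum_tail 0 df.
by rewrite /psum !big_ord0 addr0 subr0 expr0 mulr1.
Qed.

Lemma gdom_weak f A r A' r' : gdom f A r -> A <= A' -> r <= r' -> r' < 1 ->
  gdom f A' r'.
Proof.
move=> df AA rr r1'; have A0 := gdom_ge0 df; have [r0 r1 dff] := df.
split => //; first exact: lt_le_trans rr.
move=> k; apply: le_trans (dff k) _.
apply: ler_pM => //; first by rewrite exprn_ge0// ltW.
by rewrite lerXn2r// ?nnegrE; lra.
Qed.

Lemma zsummable_ext f g : f =1 g -> zsummable f -> zsummable g.
Proof. by move=> /funext->. Qed.

Lemma zsummableD f g : zsummable f -> zsummable g -> zsummable (fun k => f k + g k).
Proof.
move=> [A [r df]] [B [s dg]].
have A0 := gdom_ge0 df; have B0 := gdom_ge0 dg.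
have [r0 r1 _] := df; have [s0 s1 _] := dg.
have [t [t1 rt st]] : exists t, [/\ t < 1, r <= t & s <= t].
  by exists (Num.max r s); split; rewrite ?gt_max ?r1// le_max lexx ?orbT.
have [_ _ hf] := gdom_weak df (lexx _) rt t1.
have [_ _ hg] := gdom_weak dg (lexx _) st t1.
exists (A + B), t; split => //; first lra.
by move=> k; rewrite mulrDl; apply: le_trans (nmD _ _) _; exact: lerD.
Qed.

Lemma zsummableZ c f : zsummable f -> zsummable (fun k => c * f k).
Proof.
move=> [A [r [r0 r1 df]]]; exists (nm c * A), r; split => // k.
by rewrite nmM -mulrA ler_wpM2l// nm_ge0.
Qed.

Lemma zsummableN f : zsummable f -> zsummable (fun k => - f k).
Proof.
by move=> [A [r [r0 r1 df]]]; exists A, r; split => // k; rewrite nmN.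
Qed.

Lemma psumD f g n : psum (fun k => f k + g k) n = psum f n + psum g n.
Proof. by rewrite /psum !big_split /= addrACA. Qed.

Lemma psumZ c f n : psum (fun k => c * f k) n = c * psum f n.
Proof. by rewrite /psum mulrDr !big_distrr. Qed.

Lemma sumZD f g : zsummable f -> zsummable g ->
  sumZ (fun k => f k + g k) = sumZ f + sumZ g.
Proof.
move=> sf sg; apply: sumZ_unique; first exact: zsummableD.
under eq_fun do rewrite psumD.
by apply: cvgD; exact: psum_cvg.
Qed.

Lemma sumZZ c f : zsummable f -> sumZ (fun k => c * f k) = c * sumZ f.
Proof.
move=> sf; apply: sumZ_unique; first exact: zsummableZ.
under eq_fun do rewrite psumZ.
by apply: cvgM; [exact: cvg_cst|exact: psum_cvg].
Qed.

Lemma sumZN f : zsummable f -> sumZ (fun k => - f k) = - sumZ f.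
Proof.
move=> sf; rewrite -[RHS]mulN1r -sumZZ//; congr sumZ.
by apply/funext => k; rewrite mulN1r.
Qed.

Lemma sumZB f g : zsummable f -> zsummable g ->
  sumZ (fun k => f k - g k) = sumZ f - sumZ g.
Proof. by move=> sf sg; rewrite sumZD ?sumZN//; exact: zsummableN. Qed.

(** The reflection k -> - 1 - k exchanges the two one-sided series, so no convergence is
    involved. *)
Lemma sumZ_rev f : sumZ (fun k => f (- 1 - k)) = sumZ f.
Proof.
rewrite /sumZ addrC; congr (limn (series _) + limn (series _));
  apply/funext => k; congr f; lia.
Qed.

Lemma zsummable_rev f : zsummable f -> zsummable (fun k => f (- 1 - k)).
Proof.
move=> [A [r df]]; have A0 := gdom_ge0 df; case: df => r0 r1 df.
exists (A / r), r; split => // k; apply: le_trans (df _) _.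
rewrite -mulrA ler_wpM2l// ler_pdivlMl// -exprS ler_wiXn2l ?(ltW r0) ?(ltW r1)//; lia.
Qed.

Lemma zsummable_shift f m : zsummable f -> zsummable (fun k => f (k + m)).
Proof.
move=> [A [r df]]; have A0 := gdom_ge0 df; case: df => r0 r1 df.
exists (A / r ^+ `|m|%N), r; split => // k; apply: le_trans (df _) _.
rewrite -mulrA ler_wpM2l// ler_pdivlMl ?exprn_gt0// -exprD.
rewrite ler_wiXn2l ?(ltW r0) ?(ltW r1)//; lia.
Qed.

Lemma zsummable_cvg0 f (u : nat -> int) : zsummable f ->
  (forall n, n <= `|u n|)%N -> f (u n) @[n --> \oo] --> (0 : C).
Proof.
move=> [A [r df]] un; have A0 := gdom_ge0 df; case: df => r0 r1 df.
apply: cvg_nm => e e0.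
have : A * r ^+ n @[n --> \oo] --> (0 : R).
  by apply: cvg_geometric; rewrite ger0_norm// ltW.
move=> /cvgrPdist_le /(_ _ e0); apply: filterS => n.
rewrite sub0r normrN subr0 => h.
apply: le_trans (df _) _; apply: le_trans (le_trans (ler_norm _) h).
by rewrite ler_wpM2l// ler_wiXn2l ?(ltW r0) ?(ltW r1).
Qed.

Lemma sumZ_shift1 f : zsummable f -> sumZ (fun k => f (k + 1)) = sumZ f.
Proof.
move=> sf; apply: sumZ_unique; first exact: zsummable_shift.
(* Shifting the window gains the term at [n] and loses the one at [- n]; both tend to 0. *)
have E n : psum (fun k => f (k + 1)) n = psum f n + f n%:Z - f (- n%:Z).
  elim: n => [|n IH]; first by rewrite /psum !big_ord0 oppr0; ring.
  rewrite !psumS IH.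
  have -> : - (n.+1)%:Z + 1 = - n%:Z by lia.
  have -> : n%:Z + 1 = n.+1%:Z by lia.
  ring.
under eq_fun do rewrite E.
have -> : sumZ f = sumZ f + 0 - 0 by rewrite addr0 subr0.
apply: cvgB; last by apply: zsummable_cvg0 => // n; lia.
apply: cvgD; first exact: psum_cvg.
exact: zsummable_cvg0.
Qed.

Lemma sumZ_shift f m : zsummable f -> sumZ (fun k => f (k + m)) = sumZ f.
Proof.
have P g (n : nat) : zsummable g -> sumZ (fun k => g (k + n%:Z)) = sumZ g.
  elim: n g => [|n IH] g sg.
    by congr sumZ; apply/funext => k; rewrite addr0.
  rewrite -(sumZ_shift1 sg) -[RHS]IH; last exact: zsummable_shift.
  by congr sumZ; apply/funext => k; congr g; lia.
case: m => n sf; first exact: P.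
rewrite -[LHS](@P _ n.+1); last exact: zsummable_shift.
by congr sumZ; apply/funext => k; congr f; lia.
Qed.

Lemma sumZ_reflect f a : zsummable f ->
  sumZ (fun k => f (a - k)) = sumZ f.
Proof.
move=> sf; rewrite -(sumZ_shift (a + 1) sf) -[RHS]sumZ_rev.
by congr sumZ; apply/funext => k; congr f; lia.
Qed.

Lemma zsummable_even f : zsummable f -> zsummable (fun k => f (2 * k)).
Proof.
move=> [A [r df]]; have A0 := gdom_ge0 df; case: df => r0 r1 df.
exists A, r; split => // k; apply: le_trans (df _) _.
by rewrite ler_wpM2l// ler_wiXn2l ?(ltW r0) ?(ltW r1)//; lia.
Qed.

Lemma zsummable_odd f : zsummable f -> zsummable (fun k => f (2 * k + 1)).
Proof. by move=> sf; exact: (@zsummable_even (fun k => f (k + 1)) (zsummable_shift 1 sf)). Qed.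

Lemma sumZ_parity f : zsummable f ->
  sumZ (fun k => f (2 * k)) + sumZ (fun k => f (2 * k + 1)) = sumZ f.
Proof.
move=> sf; have se := zsummable_even sf; have so := zsummable_odd sf.
rewrite -sumZD//; apply: sumZ_unique; first exact: zsummableD.
have E n : psum (fun k => f (2 * k) + f (2 * k + 1)) n = psum f (2 * n).
  elim: n => [|n IH]; first by rewrite /psum !big_ord0.
  rewrite mulnS add2n !psumS IH -!addrA; congr (_ + _).
  have -> : 2 * - (n.+1)%:Z = - ((2 * n).+2)%:Z by lia.
  have -> : - ((2 * n).+2)%:Z + 1 = - ((2 * n).+1)%:Z by lia.
  have -> : 2 * n%:Z + 1 = (2 * n).+1%:Z by lia.
  have -> : 2 * n%:Z = (2 * n)%N%:Z by lia.
  ring.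
under eq_fun do rewrite E.
apply: (@cvg_comp _ _ _ (fun n : nat => (2 * n)%N) (psum f) \oo%classic) (psum_cvg sf).
move=> P [N _ HN]; exists N => // n /= Nn; apply: HN => /=.
by rewrite (leq_trans Nn)// leq_pmull.
Qed.

Lemma cvg_psum {T} {F : set_system T} {FF : Filter F} (f : T -> int -> C) g n :
  (forall k, f t k @[t --> F] --> g k) -> psum (f t) n @[t --> F] --> psum g n.
Proof.
move=> H; elim: n => [|n IH].
  rewrite /psum !big_ord0; under eq_fun do rewrite !big_ord0.
  exact: cvg_cst.
rewrite psumS; under eq_fun do rewrite psumS.
exact: (cvgD IH (cvgD (H n%:Z) (H (- (n.+1)%:Z)))).
Qed.

(** Dominated convergence: the common bound makes both tails beyond some [n] smaller than e / 3, and
    on the finite window termwise convergence suffices. *)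
Lemma tannery {T} {F : set_system T} {FF : Filter F} (f : T -> int -> C) g A r :
  0 < r -> r < 1 ->
  (\forall t \near F, forall k, nm (f t k) <= A * r ^+ `|k|%N) ->
  (forall k, nm (g k) <= A * r ^+ `|k|%N) ->
  (forall k, f t k @[t --> F] --> g k) ->
  sumZ (f t) @[t --> F] --> sumZ g.
Proof.
move=> r0 r1 df dg H.
have gg : gdom g A r by [].
have A0 := gdom_ge0 gg.
have r1' : 0 < 1 - r by rewrite subr_gt0.
apply: cvg_nm => e e0.
have e30 : 0 < e / 3 by lra.
have [n hn] : exists n, 2 * A * r ^+ n / (1 - r) <= e / 3.
  have : 2 * A / (1 - r) * r ^+ n @[n --> \oo] --> (0 : R).
    by apply: cvg_geometric; rewrite ger0_norm// ltW.
  move=> /cvgrPdist_le /(_ _ e30) [n _ /(_ n (leqnn n))] /=.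
  rewrite sub0r normrN => h; exists n; apply: le_trans h.
  by apply: le_trans (ler_norm _); rewrite le_eqVlt; apply/orP; left; apply/eqP; ring.
near=> t.
have ft : gdom (f t) A r by split => //; near: t.
have -> : sumZ (f t) - sumZ g =
  (sumZ (f t) - psum (f t) n) + ((psum (f t) n - psum g n) - (sumZ g - psum g n)) by ring.
have -> : e = e / 3 + (e / 3 + e / 3) by lra.
apply: le_trans (nmD _ _) _; apply: lerD.
  exact: le_trans (psum_tail _ ft) hn.
apply: le_trans (nmD _ _) _; rewrite nmN; apply: lerD; last first.
  exact: le_trans (psum_tail _ gg) hn.
by near: t; apply: nm_cvg => //; exact: cvg_psum.
Unshelve. all: by end_near. Qed.

Lemma zsummable0 : zsummable (fun=> 0).
Proof.
exists 0, 2^-1; split; [lra|lra|] => k; by rewrite nm0 mul0r.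
Qed.

Lemma sumZ0 : sumZ (fun=> 0 : C) = 0.
Proof.
apply: sumZ_unique; first exact: zsummable0.
rewrite /psum; under eq_fun do rewrite !big1//= addr0.
exact: cvg_cst.
Qed.

Lemma sumZ_psum (f : int -> int -> C) n :
  (forall m, zsummable (fun k => f k m)) ->
  sumZ (fun k => psum (f k) n) = psum (fun m => sumZ (fun k => f k m)) n /\
  zsummable (fun k => psum (f k) n).
Proof.
move=> sf; elim: n => [|n [IH1 IH2]].
  rewrite /psum !big_ord0; under eq_fun do rewrite !big_ord0.
  by rewrite addr0 sumZ0; split => //; exact: zsummable0.
rewrite psumS; under eq_fun do rewrite psumS.
have s2 : zsummable (fun k => f k n%:Z + f k (- n.+1%:Z)) by exact: zsummableD.
by split; [rewrite sumZD// IH1 sumZD|exact: zsummableD].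
Qed.

(** For a finite window in [m] the exchange is linearity; the windows are dominated uniformly, so
    [tannery] lets them grow. *)
Lemma sumZ_fubini (f : int -> int -> C) A r : 0 < r -> r < 1 ->
  (forall k m, nm (f k m) <= A * r ^+ `|k|%N * r ^+ `|m|%N) ->
  sumZ (fun k => sumZ (f k)) = sumZ (fun m => sumZ (fun k => f k m)).
Proof.
move=> r0 r1 df.
have r1' : 0 < 1 - r by rewrite subr_gt0.
have d1 k : gdom (f k) (A * r ^+ `|k|%N) r by [].
have d2 m : gdom (fun k => f k m) (A * r ^+ `|m|%N) r.
  by split => // k; rewrite mulrAC.
have s2 : zsummable (fun m => sumZ (fun k => f k m)).
  exists (2 * A / (1 - r)), r; split => // m.
  have -> : 2 * A / (1 - r) * r ^+ `|m|%N = 2 * (A * r ^+ `|m|%N) / (1 - r) by ring.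
  exact: nm_sumZ (d2 m).
have s2' m : zsummable (fun k => f k m) by exists (A * r ^+ `|m|%N), r.
apply/esym/sumZ_unique => //.
under eq_fun => n do rewrite -(sumZ_psum n s2').1.
apply: (@tannery _ _ _ (fun n k => psum (f k) n) (fun k => sumZ (f k)) (2 * A / (1 - r)) r) => //.
- near=> n => k; apply: le_trans (nm_psum _ (d1 k)) _.
  by rewrite le_eqVlt; apply/orP; left; apply/eqP; ring.
- move=> k; apply: le_trans (nm_sumZ (d1 k)) _.
  by rewrite le_eqVlt; apply/orP; left; apply/eqP; ring.
- by move=> k; apply: psum_cvg; exists (A * r ^+ `|k|%N), r.
Unshelve. all: by end_near. Qed.

Lemma zsummable_sumZ (f : int -> int -> C) A r : 0 < r -> r < 1 ->
  (forall k m, nm (f k m) <= A * r ^+ `|k|%N * r ^+ `|m|%N) ->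
  zsummable (fun k => sumZ (f k)).
Proof.
move=> r0 r1 df; exists (2 * A / (1 - r)), r; split => // k.
have d1 : gdom (f k) (A * r ^+ `|k|%N) r by [].
by apply: le_trans (nm_sumZ d1) _; rewrite le_eqVlt; apply/orP; left; apply/eqP; ring.
Qed.

End TwoSidedSums.

(** * The Jacobi triple product *)

Section Growth.
Variable R : realType.
Local Notation C := (Cplx R).

(** The number k(k-1)/2, which is nonnegative on all integers; as a [nat] it can be used with [^+],
    without inverses of q. *)
Definition tri (k : int) : nat :=
  match k with Posz n => 'C(n, 2) | Negz n => 'C(n.+2, 2) end.

Lemma bin2_mul (n : nat) : (2 * 'C(n, 2) = n * n.-1)%N.
Proof. by elim: n => [|n IH]//; rewrite binS bin1 mulnDr IH; case: n {IH} => [|n] /=; nia. Qed.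

Lemma tri2 k : 2 * (tri k)%:Z = k * (k - 1).
Proof.
case: k => n; rewrite /tri ?NegzE; last first.
  by have := bin2_mul n.+2; move: 'C(_, _) => c /=; nia.
by have := bin2_mul n; move: 'C(_, _) => c; case: n => [|n] /=; nia.
Qed.

Lemma triD k l : (tri (k + l))%:Z = (tri k)%:Z + (tri l)%:Z + k * l.
Proof. by have := tri2 (k + l); have := tri2 k; have := tri2 l; nia. Qed.

Lemma tri1B k : tri (1 - k) = tri k.
Proof. by have := tri2 (1 - k); have := tri2 k; nia. Qed.

(** Quadratic beats linear: complete the square around k = m + 1, respectively k = - (m + 1). *)
Lemma tri_growth (m : nat) k : (m * `|k| <= tri k + m.+1 ^ 2)%N.
Proof.
have := tri2 k.
case: (lerP 0 k) => k0.
  have := sqr_ge0 (k - m%:Z - 1); rewrite expr2 -mulnn; nia.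
have := sqr_ge0 (k + m%:Z + 1); rewrite expr2 -mulnn; nia.
Qed.

Lemma exprn_small (rho e : R) : 0 <= rho -> rho < 1 -> 0 < e ->
  exists n, rho ^+ n <= e.
Proof.
move=> r0 r1 e0.
have : 1 * rho ^+ n @[n --> \oo] --> (0 : R).
  by apply: cvg_geometric; rewrite ger0_norm.
move=> /cvgrPdist_le /(_ _ e0) [n _ /(_ n (leqnn n))] /=.
by rewrite sub0r normrN mul1r => h; exists n; exact: le_trans (ler_norm _) h.
Qed.

(** Choose m with rho^m B <= r; by [tri_growth] the factor rho^(tri k) pays for rho^(m |k|) up to
    the constant rho^(-(m+1)^2). Growth [B] and rate [r] are thus arbitrary. *)
Lemma tri_dom (rho B r : R) : 0 < rho -> rho < 1 -> 0 <= B -> 0 < r ->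
  exists2 A, 0 <= A & forall k, rho ^+ tri k * B ^+ `|k|%N <= A * r ^+ `|k|%N.
Proof.
move=> r0 r1 B0 e0.
have e1 : 0 < r / (1 + B) by rewrite divr_gt0//; lra.
have [m hm] := exprn_small (ltW r0) r1 e1.
have hm' : rho ^+ m * B <= r.
  have : rho ^+ m * (1 + B) <= r by rewrite -ler_pdivlMr//; lra.
  have : 0 <= rho ^+ m by rewrite exprn_ge0// ltW.
  by rewrite mulrDr mulr1; lra.
have c0 : 0 < rho ^+ (m.+1 ^ 2) by rewrite exprn_gt0.
exists (rho ^+ (m.+1 ^ 2))^-1 => [|k]; first by rewrite invr_ge0 ltW.
rewrite ler_pdivlMl// mulrA -exprD.
apply: (@le_trans _ _ (rho ^+ (m * `|k|) * B ^+ `|k|%N)).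
  rewrite ler_wpM2r ?exprn_ge0// ler_wiXn2l ?(ltW r0) ?(ltW r1)//.
  by rewrite addnC tri_growth.
rewrite exprM -exprMn lerXn2r// nnegrE; last exact: ltW.
by rewrite mulr_ge0// exprn_ge0// ltW.
Qed.

Lemma nm_exprz (y : C) k : y != 0 -> nm (y ^ k) <= (nm y + (nm y)^-1) ^+ `|k|%N.
Proof.
rewrite -nm_gt0 nmXz => y0; have yi0 : 0 < (nm y)^-1 by rewrite invr_gt0.
case: k => n; rewrite ?NegzE.
  by rewrite -exprnP lerXn2r// ?nnegrE; lra.
by rewrite -exprnN abszN /= -exprVn lerXn2r// ?nnegrE; lra.
Qed.

Lemma theta_dom (y q : C) (r : R) : y != 0 -> q != 0 -> nm q < 1 -> 0 < r ->
  exists2 A, 0 <= A & forall k, nm (y ^ k * q ^+ tri k) <= A * r ^+ `|k|%N.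
Proof.
move=> y0 q0 q1 r0.
have [||||A A0 HA] := @tri_dom (nm q) (nm y + (nm y)^-1) r; rewrite ?nm_gt0//.
  by rewrite addr_ge0 ?invr_ge0 ?nm_ge0.
exists A => // k; apply: le_trans (HA k); rewrite nmM nmX mulrC.
by rewrite ler_wpM2l ?exprn_ge0 ?nm_ge0// nm_exprz.
Qed.

End Growth.

(** * The products (a; q)_n and their limits *)

Section Pochhammer.
Variables (R : realType) (q : Cplx R).
Hypotheses (q0 : q != 0) (q1 : nm q < 1).
Local Notation C := (Cplx R).
Local Notation rho := (nm q).

Definition poch (a : C) n := \prod_(i < n) (1 - a * q ^+ i).
Definition Poch a : C := limn (poch a).

Lemma pochS a n : poch a n.+1 = poch a n * (1 - a * q ^+ n).
Proof. by rewrite /poch big_ord_recr. Qed.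

Lemma poch0 a : poch a 0 = 1. Proof. by rewrite /poch big_ord0. Qed.

Lemma pochD a m n : poch a (m + n) = poch a m * poch (a * q ^+ m) n.
Proof.
elim: n => [|n IH]; first by rewrite addn0 poch0 mulr1.
by rewrite addnS !pochS IH mulrA exprD mulrA.
Qed.

Lemma nm_base_gt0 : 0 < rho. Proof. by rewrite nm_gt0. Qed.
Lemma one_sub_base_gt0 : 0 < 1 - rho. Proof. by rewrite subr_gt0. Qed.

Lemma nm_poch a n : nm (poch a n) <= expR (nm a / (1 - rho)).
Proof.
have rho0 := nm_base_gt0; have rho1 := one_sub_base_gt0.
(* The induction needs the partial geometric sum in the exponent; each factor is bounded by 1 + t <=
   exp t. *)
suff : nm (poch a n) <= expR (nm a / (1 - rho) * (1 - rho ^+ n)).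
  move=> /le_trans; apply; rewrite ler_expR ler_piMr ?divr_ge0 ?nm_ge0 ?(ltW rho1)//.
  by rewrite gerBl exprn_ge0// nm_ge0.
elim: n => [|n IH]; first by rewrite poch0 nm1 expr0 subrr mulr0 expR0.
rewrite pochS nmM.
have -> : nm a / (1 - rho) * (1 - rho ^+ n.+1) =
  nm a / (1 - rho) * (1 - rho ^+ n) + nm a * rho ^+ n by rewrite exprS; field; lra.
rewrite expRD ler_pM ?nm_ge0//.
apply: le_trans (nmD _ _) _; rewrite nm1 nmN nmM nmX.
exact: expR_ge1Dx.
Qed.

(** The increments are - (a; q)_n a q^n, geometrically small by [nm_poch], so the telescoping series
    converges. *)
Lemma poch_cvg a : poch a n @[n --> \oo] --> Poch a.
Proof.
have rho0 := nm_base_gt0; have rho1 := one_sub_base_gt0.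
set K := expR (nm a / (1 - rho)).
have cs : cvgn (series (fun n => poch a n.+1 - poch a n)).
  apply: (@cvgn_series_geom _ _ (K * nm a) rho); first by rewrite ltW.
  move=> k; have -> : poch a k.+1 - poch a k = - (poch a k * (a * q ^+ k)).
    by rewrite pochS; ring.
  by rewrite nmN !nmM nmX -mulrA ler_wpM2r ?nm_poch// mulr_ge0 ?exprn_ge0 ?nm_ge0.
have E : poch a = fun n => 1 + series (fun n => poch a n.+1 - poch a n) n.
  by apply/funext => n; rewrite seriesEnat /= telescope_sumr// poch0; ring.
have : cvgn (poch a); last by [].
rewrite E; apply: is_cvgD; first exact: is_cvg_cst.
exact: cs.
Qed.

Lemma Poch_split a m : Poch a = poch a m * Poch (a * q ^+ m).
Proof.
have rho0 := nm_base_gt0; have rho1 := one_sub_base_gt0.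
have c1 : poch a (n + m)%N @[n --> \oo] --> Poch a.
  by rewrite (cvg_shiftn m); exact: poch_cvg.
have c2 : poch a (n + m)%N @[n --> \oo] --> poch a m * Poch (a * q ^+ m).
  under eq_fun do rewrite addnC pochD.
  by apply: cvgM; [exact: cvg_cst|exact: poch_cvg].
exact: norm_cvg_unique c1 c2.
Qed.

(** From an index M on, the moduli of a q^i add up to at most 1/2, and a product of factors 1 - b_i
    is bounded below by 1 minus the sum of the |b_i|. The finitely many partial products up to M
    have a positive minimum. *)
Lemma poch_lower a : (forall i, a * q ^+ i != 1) ->
  exists2 c, 0 < c & forall n, c <= nm (poch a n).
Proof.
have rho0 := nm_base_gt0; have rho1 := one_sub_base_gt0.
move=> a1.
have e0 : 0 < (1 - rho) / (2 * (1 + nm a)).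
  by rewrite divr_gt0//; have := nm_ge0 a; lra.
have [M hM] := exprn_small (ltW rho0) q1 e0.
set s := nm a * rho ^+ M / (1 - rho).
have s0 : 0 <= s by rewrite !mulr_ge0 ?nm_ge0 ?exprn_ge0 ?invr_ge0 ?(ltW rho1) ?nm_ge0.
have s2 : s <= 2^-1.
  rewrite /s ler_pdivrMr//.
  have := nm_ge0 a; move: hM; rewrite ler_pdivlMr; last by have := nm_ge0 a; lra.
  have := exprn_ge0 M (ltW rho0); nra.
have low n : 1 - s * (1 - rho ^+ n) <= nm (poch (a * q ^+ M) n).
  elim: n => [|n IH]; first by rewrite poch0 nm1 expr0 subrr mulr0 subr0.
  rewrite pochS nmM; set b := nm a * rho ^+ M * rho ^+ n.
  have -> : s * (1 - rho ^+ n.+1) = s * (1 - rho ^+ n) + b.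
    by rewrite /s /b exprS; field; lra.
  have b0 : 0 <= b by rewrite !mulr_ge0 ?exprn_ge0 ?nm_ge0.
  have h : 1 - b <= nm (1 - a * q ^+ M * q ^+ n).
    have := nmD (1 - a * q ^+ M * q ^+ n) (a * q ^+ M * q ^+ n).
    by rewrite subrK nm1 !nmM !nmX -/b; lra.
  have b1 : b <= 1.
    have : b <= s by rewrite /b /s ler_wpM2l ?mulr_ge0 ?exprn_ge0 ?nm_ge0//;
      apply: (@le_trans _ _ 1);
      [rewrite exprn_ile1 ?nm_ge0 ?(ltW q1)|rewrite invf_ge1//; lra].
    lra.
  have t0 : 0 <= s * (1 - rho ^+ n).
    by rewrite mulr_ge0// subr_ge0 exprn_ile1 ?nm_ge0 ?(ltW q1).
  have t1 : s * (1 - rho ^+ n) <= s.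
    by rewrite ler_piMr// gerBl exprn_ge0// nm_ge0.
  have := nm_ge0 (poch (a * q ^+ M) n).
  nra.
have low2 n : 2^-1 <= nm (poch (a * q ^+ M) n).
  apply: le_trans (low n).
  have : s * (1 - rho ^+ n) <= s by rewrite ler_piMr// gerBl exprn_ge0// nm_ge0.
  lra.
have pn n : 0 < nm (poch a n).
  rewrite nm_gt0; apply/prodf_neq0 => i _; rewrite subr_eq0 eq_sym; exact: a1.
have [c c0 hc] : exists2 c, 0 < c & forall n, (n <= M)%N -> c <= nm (poch a n).
  elim: {low2 low s2 s0 s hM}M => [|M [c c0 hc]].
    by exists 1 => // n; rewrite leqn0 => /eqP->; rewrite poch0 nm1.
  exists (Num.min c (nm (poch a M.+1))); first by rewrite lt_min c0 pn.
  move=> n; rewrite leq_eqVlt => /orP[/eqP->|nM]; first by rewrite ge_min lexx orbT.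
  by rewrite ge_min hc.
exists (c / 2); first lra.
move=> n; case: (leqP n M) => [nM|Mn]; first by have := hc _ nM; lra.
by rewrite -(subnKC (ltnW Mn)) pochD nmM ler_pM ?(ltW c0) ?invr_ge0 ?low2 ?hc.
Qed.

Lemma Poch_neq0 a : (forall i, a * q ^+ i != 1) -> Poch a != 0.
Proof.
have rho0 := nm_base_gt0; have rho1 := one_sub_base_gt0.
move=> /poch_lower[c c0 hc]; rewrite -nm_gt0.
have e0 : 0 < c / 2 by lra.
have [n _ /(_ n (leqnn n)) /= h] := nm_cvg (@poch_cvg a) e0.
have := nmD (poch a n - Poch a) (Poch a); rewrite subrK; have := hc n; lra.
Qed.

End Pochhammer.

Definition th (R : realType) (q y : Cplx R) : Cplx R :=
  sumZ (fun n => y ^ n * q ^+ tri n).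

Lemma sumZ_single (R : realType) (f : int -> Cplx R) :
  (forall k, k != 0 -> f k = 0) -> sumZ f = f 0.
Proof.
move=> f0; apply: sumZ_unique.
  exists (nm (f 0)), 2^-1; split; [lra|lra|] => k.
  have [->|/f0->] := eqVneq k 0; first by rewrite expr0 mulr1.
  by rewrite nm0 mulr_ge0 ?nm_ge0 ?exprn_ge0// invr_ge0.
have E n : psum f (n + 1) = f 0.
  rewrite addn1 /psum big_ord_recl big1 => [|i _]; last by rewrite f0.
  by rewrite big1 ?addr0// => i _; rewrite f0.
rewrite -(cvg_shiftn 1); under eq_fun do rewrite E.
exact: cvg_cst.
Qed.

(** * The finite triple product, its derivative at -1, and their limits *)

Section TripleProduct.
Variables (R : realType) (q : Cplx R).
Hypotheses (q0 : q != 0) (q1 : nm q < 1).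
Local Notation C := (Cplx R).

Lemma expq_neq1 (i : nat) : q * q ^+ i != 1.
Proof.
apply/eqP => /(congr1 (@nm R)); rewrite -exprS nmX nm1 => h.
have : nm q ^+ i.+1 < 1 by rewrite exprn_ilt1// nm_ge0.
by rewrite h ltxx.
Qed.

Lemma pochq_neq0 n : poch q q n != 0.
Proof. by apply/prodf_neq0 => i _; rewrite subr_eq0 eq_sym expq_neq1. Qed.

Lemma Pochq_neq0 : Poch q q != 0.
Proof. by apply: Poch_neq0 => //; exact: expq_neq1. Qed.

(* With the convention 1 / (q; q)_n = 0 for n < 0, the recurrence rinvB1 holds
   for all n, so the Gaussian binomial coefficients in acoef need no boundary
   cases. *)
Definition rinv (n : int) : C :=
  match n with Posz m => (poch q q m)^-1 | Negz _ => 0 end.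

Lemma rinvB1 n : rinv (n - 1) = (1 - q ^ n) * rinv n.
Proof.
case: n => [[|n]|n]; first by rewrite expr0z subrr mul0r.
- have -> : n.+1%:Z - 1 = n by lia.
  rewrite /rinv pochS -exprnP exprS; have := pochq_neq0 n.+1; have := pochq_neq0 n.
  rewrite pochS mulf_eq0 negb_or => h /andP[_ h2]; field; exact/andP.
- have -> : Negz n - 1 = Negz n.+1 by rewrite !NegzE; lia.
  by rewrite /rinv mulr0.
Qed.

(** The Gaussian binomial of 2N over N + k times q^(k(k-1)/2): the Laurent coefficients of the
    product over i < N of (1 + y q^i)(1 + q^(i+1) / y). *)
Definition acoef (N : nat) (k : int) : C :=
  poch q q (2 * N) * rinv (N%:Z - k) * rinv (N%:Z + k) * q ^+ tri k.

(** The coefficients are multiplied by (1 + y q^N)(1 + q^(N+1) / y) = 1 + q^(2N+1) + y q^N + q^(N+1)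
    / y. In terms of u = q^(N+1-k) and v = q^(N+1+k), with u v = q^(2N+2), the claim is a rational
    identity. *)
Lemma acoefS N k : acoef N.+1 k =
  (1 + q ^+ (2 * N).+1) * acoef N k + q ^+ N * acoef N (k - 1)
  + q ^+ N.+1 * acoef N (k + 1).
Proof.
rewrite /acoef.
set A := rinv (N.+1%:Z - k); set B := rinv (N.+1%:Z + k).
set u := q ^ (N.+1%:Z - k); set v := q ^ (N.+1%:Z + k).
have r1 : rinv (N%:Z - k) = (1 - u) * A.
  by rewrite -rinvB1; congr rinv; lia.
have r2 : rinv (N%:Z + k) = (1 - v) * B.
  by rewrite -rinvB1; congr rinv; lia.
have -> : N%:Z - (k - 1) = N.+1%:Z - k by lia.
have -> : N%:Z + (k + 1) = N.+1%:Z + k by lia.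
have -> : rinv (N%:Z + (k - 1)) = (1 - v / q) * ((1 - v) * B).
  rewrite -r2 /v -[q^-1]/(q ^ (- 1)) -expfzDr//.
  have -> : N%:Z + (k - 1) = (N%:Z + k) - 1 by lia.
  by rewrite rinvB1; congr (_ * _); congr (1 - q ^ _); lia.
have -> : rinv (N%:Z - (k + 1)) = (1 - u / q) * ((1 - u) * A).
  rewrite -r1 /u -[q^-1]/(q ^ (- 1)) -expfzDr//.
  have -> : N%:Z - (k + 1) = (N%:Z - k) - 1 by lia.
  by rewrite rinvB1; congr (_ * _); congr (1 - q ^ _); lia.
have t1 : q ^+ N * q ^+ tri (k - 1) = q ^+ tri k * u.
  rewrite /u !exprnP -!expfzDr//; congr (q ^ _).
  by rewrite triD (_ : tri (- 1) = 1%N)//; lia.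
have t2 : q ^+ N.+1 * q ^+ tri (k + 1) = q ^+ tri k * v.
  rewrite /v !exprnP -!expfzDr//; congr (q ^ _).
  by rewrite triD (_ : tri 1 = 0%N)//; lia.
have uv : u * v = q ^+ (2 * N).+2.
  by rewrite /u /v -expfzDr// exprnP; congr (q ^ _); lia.
have uvq : q ^+ (2 * N).+1 = u * v / q by rewrite uv [X in X / q]exprSr mulfK.
have -> : (2 * N.+1 = (2 * N).+2)%N by lia.
rewrite -/A -/B !pochS -!exprS uvq -uv r1 r2.
transitivity (poch q q (2 * N) * (q ^+ tri k * ((1 + u * v / q) * (1 - u) * A * (1 - v) * B)
  + (q ^+ tri k * u) * (A * (1 - v / q) * (1 - v) * B)
  + (q ^+ tri k * v) * (B * (1 - u / q) * (1 - u) * A))); last first.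
  by rewrite -t1 -t2; ring.
by field.
Qed.

Lemma acoef0 k : acoef 0 k = (k == 0)%:R.
Proof.
rewrite /acoef poch0 mul1r sub0r add0r; case: k => [[|n]|n] /=.
- by rewrite poch0 invr1 !mulr1.
- by rewrite !mul0r.
- by rewrite mulr0 mul0r.
Qed.

Lemma rinv_bound : exists2 K, 0 <= K & forall n, nm (rinv n) <= K.
Proof.
have [c c0 hc] := poch_lower q0 q1 expq_neq1.
exists c^-1 => [|[n|n]]; first by rewrite invr_ge0 ltW.
  by rewrite /= nmV lef_pV2 ?posrE// ?hc// (lt_le_trans c0).
by rewrite /= nm0 invr_ge0 ltW.
Qed.

(** Uniformity in [N] is the point: it is the domination for letting [N] tend to infinity. *)
Lemma acoef_dom (D B : R) : 0 <= D -> 0 <= B ->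
  exists2 A, 0 <= A & forall N k c, nm c <= D * B ^+ `|k|%N ->
    nm (acoef N k * c) <= A * 2^-1 ^+ `|k|%N.
Proof.
move=> D0 B0; have [K K0 hK] := rinv_bound.
have [||A A0 hA] := @tri_dom R (nm q) B 2^-1 _ q1 B0; rewrite ?nm_gt0 ?invr_gt0//.
set L := expR (nm q / (1 - nm q)).
have L0 : 0 <= L by exact: expR_ge0.
exists (L * K * K * D * A) => [|N k c hc]; first by rewrite !mulr_ge0.
rewrite /acoef !nmM nmX.
have h1 : nm (poch q q (2 * N)) * nm (rinv (N%:Z - k)) * nm (rinv (N%:Z + k)) <= L * K * K.
  by rewrite !ler_pM ?mulr_ge0 ?nm_ge0 ?nm_poch.
apply: (@le_trans _ _ (L * K * K * nm q ^+ tri k * (D * B ^+ `|k|%N))).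
  by rewrite ler_pM ?nm_ge0 ?mulr_ge0 ?exprn_ge0 ?nm_ge0// ler_wpM2r// exprn_ge0// nm_ge0.
have -> : L * K * K * nm q ^+ tri k * (D * B ^+ `|k|%N) =
  (L * K * K * D) * (nm q ^+ tri k * B ^+ `|k|%N) by ring.
by rewrite -[leRHS]mulrA ler_wpM2l ?mulr_ge0.
Qed.

(** The recurrence with its shifts moved onto the weight. The weight y^k gives the triple product,
    and k (-1)^k its derivative at y = -1. *)
Lemma acoef_sumS (c : int -> C) (D B : R) N :
  0 <= D -> 1 <= B -> (forall k, nm (c k) <= D * B ^+ `|k|%N) ->
  sumZ (fun k => acoef N.+1 k * c k) =
    (1 + q ^+ (2 * N).+1) * sumZ (fun k => acoef N k * c k)
    + q ^+ N * sumZ (fun k => acoef N k * c (k + 1))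
    + q ^+ N.+1 * sumZ (fun k => acoef N k * c (k - 1)).
Proof.
move=> D0 B1 hc; have B0 : 0 <= B by lra.
have DB0 : 0 <= D * B by exact: mulr_ge0.
have [A A0 hA] := acoef_dom DB0 B0.
have sc l : (`|l| <= 1)%N -> zsummable (fun k => acoef N k * c (k + l)).
  move=> l1; exists A, 2^-1; split; [lra|lra|] => k; apply: hA.
  apply: le_trans (hc _) _; rewrite -mulrA ler_wpM2l// -exprS ler_weXn2l//; lia.
have s0 : zsummable (fun k => acoef N k * c k).
  by have := sc 0 isT; under eq_fun do rewrite addr0.
have sp := sc 1 isT; have sm := sc (- 1) isT.
have sp' : zsummable (fun k => acoef N (k - 1) * c k).
  by have := zsummable_shift (- 1) sp; under eq_fun do rewrite subrK.
have sm' : zsummable (fun k => acoef N (k + 1) * c k).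
  by have := zsummable_shift 1 sm; under eq_fun do rewrite addrK.
have -> : sumZ (fun k => acoef N k * c (k + 1)) = sumZ (fun k => acoef N (k - 1) * c k).
  by rewrite -(sumZ_shift (- 1) sp); congr sumZ; apply/funext => k; rewrite subrK.
have -> : sumZ (fun k => acoef N k * c (k - 1)) = sumZ (fun k => acoef N (k + 1) * c k).
  by rewrite -(sumZ_shift 1 sm); congr sumZ; apply/funext => k; rewrite addrK.
have z0 := zsummableZ (1 + q ^+ (2 * N).+1) s0.
have zp := zsummableZ (q ^+ N) sp'.
have zm := zsummableZ (q ^+ N.+1) sm'.
rewrite -(sumZZ _ s0) -(sumZZ _ sp') -(sumZZ _ sm').
rewrite -(sumZD z0 zp) -(sumZD (zsummableD z0 zp) zm).
by congr sumZ; apply/funext => k; rewrite acoefS; ring.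
Qed.

Lemma triple_product_fin y N : y != 0 ->
  sumZ (fun k => acoef N k * y ^ k) = poch q (- y) N * poch q (- q / y) N.
Proof.
move=> y0; elim: N => [|N IH].
  rewrite sumZ_single => [|k /negbTE k0]; first by rewrite acoef0 !poch0 expr0z.
  by rewrite acoef0 k0 mul0r.
have y0' : 0 < nm y by rewrite nm_gt0.
have yV0 : 0 < (nm y)^-1 by rewrite invr_gt0.
have B1 : 1 <= nm y + (nm y)^-1.
  have [h|h] := leP 1 (nm y); first lra.
  have : 1 <= (nm y)^-1 by rewrite invf_ge1//; exact: ltW.
  lra.
rewrite (@acoef_sumS _ 1 (nm y + (nm y)^-1))//; last first.
  by move=> k; rewrite mul1r; exact: nm_exprz.
have sy : zsummable (fun k => acoef N k * y ^ k).
  have [A A0 hA] := acoef_dom ler01 (le_trans ler01 B1).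
  exists A, 2^-1; split; [lra|lra|] => k; apply: hA.
  by rewrite mul1r; exact: nm_exprz.
have -> : (fun k => acoef N k * y ^ (k + 1)) = (fun k => y * (acoef N k * y ^ k)).
  by apply/funext => k; rewrite expfzDr// expr1z; ring.
have -> : (fun k => acoef N k * y ^ (k - 1)) = (fun k => y^-1 * (acoef N k * y ^ k)).
  by apply/funext => k; rewrite expfzDr// -[y ^ (-1)]/(y^-1); ring.
rewrite !sumZZ// IH !pochS.
have -> : (2 * N = N + N)%N by lia.
by rewrite !exprS exprD; field.
Qed.

(** This is y d/dy of the finite product at y = -1, where 1 + y is the only vanishing factor; the
    right side is the product of the others, times y = -1. *)
Lemma triple_product_deriv_fin N :
  sumZ (fun k => acoef N.+1 k * (k%:~R * (- 1) ^ k)) =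
  - poch q q N * poch q q N.+1.
Proof.
have hc (k : int) : nm (k%:~R * (- 1) ^ k) <= 1 * 2 ^+ `|k|%N :> R.
  by rewrite mul1r nm_sign_int.
have hm (k : int) : nm ((- 1) ^ k : C) <= 1 * 2 ^+ `|k|%N :> R.
  by rewrite nmXz nmN nm1 exp1rz mul1r exprn_ege1//; lra.
have sm N' : zsummable (fun k => acoef N' k * (- 1) ^ k).
  have [||A A0 hA] := @acoef_dom 1 2; rewrite ?ler0n//.
  by exists A, 2^-1; split; [lra|lra|] => k; exact: hA.
have sc N' : zsummable (fun k => acoef N' k * (k%:~R * (- 1) ^ k)).
  have [||A A0 hA] := @acoef_dom 1 2; rewrite ?ler0n//.
  by exists A, 2^-1; split; [lra|lra|] => k; exact: hA.
have step N' : sumZ (fun k => acoef N'.+1 k * (k%:~R * (- 1) ^ k)) =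
    (1 - q ^+ N') * (1 - q ^+ N'.+1) * sumZ (fun k => acoef N' k * (k%:~R * (- 1) ^ k))
    + (q ^+ N'.+1 - q ^+ N') * sumZ (fun k => acoef N' k * (- 1) ^ k).
  rewrite (@acoef_sumS _ 1 2) ?ler1n ?ler01//.
  have n1 : (- 1 : C) != 0 by rewrite oppr_eq0 oner_eq0.
  have -> : (fun k : int => acoef N' k * ((k + 1)%:~R * (- 1) ^ (k + 1))) =
    (fun k => - 1 * (acoef N' k * (k%:~R * (- 1) ^ k)) + - 1 * (acoef N' k * (- 1) ^ k)).
    by apply/funext => k; rewrite expfzDr// expr1z rmorphD /=; ring.
  have -> : (fun k : int => acoef N' k * ((k - 1)%:~R * (- 1) ^ (k - 1))) =
    (fun k => - 1 * (acoef N' k * (k%:~R * (- 1) ^ k)) + (acoef N' k * (- 1) ^ k)).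
    apply/funext => k; rewrite expfzDr// -[(- 1) ^ (- 1)]/((- 1)^-1) invrN1 rmorphB /=; ring.
  rewrite !sumZD ?sumZZ//; try exact: zsummableZ.
  have -> : (2 * N' = N' + N')%N by lia.
  by rewrite !exprS exprD; ring.
(* Only the passage from 0 to 1 uses the second term of [step]; later the undifferentiated sum is 0,
   since its product contains the factor 1 + y at y = -1. *)
elim: N => [|N IH].
  rewrite step subrr mul0r mul0r add0r sumZ_single => [|k /negbTE k0]; last first.
    by rewrite acoef0 k0 mul0r.
  by rewrite acoef0 eqxx mulr1n pochS poch0 expr0z !expr0 expr1; ring.
rewrite step IH triple_product_fin ?oppr_eq0 ?oner_eq0//.
have -> : poch q (- - 1) N.+1 = 0.
  by rewrite opprK /poch big_ord_recl /= expr0 mulr1 subrr mul0r.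
by rewrite mul0r mulr0 addr0 !pochS -!exprS; ring.
Qed.

Lemma cvg_rinv k : rinv (n%:Z + k) @[n --> \oo] --> (Poch q q)^-1.
Proof.
have c1 : (poch q q n)^-1 @[n --> \oo] --> (Poch q q)^-1.
  by apply: cvgV; [exact: Pochq_neq0|exact: poch_cvg].
have E (n : nat) : rinv ((n + `|k|)%N%:Z + k) = (poch q q `|(n + `|k|)%N%:Z + k|)^-1.
  have : 0 <= (n + `|k|)%N%:Z + k by lia.
  by case: (_ + k).
rewrite -(cvg_shiftn `|k|); under eq_fun do rewrite E.
have c2 : (fun n : nat => absz ((n + `|k|)%N%:Z + k)) @ \oo --> \oo.
  by move=> P [N _ HN]; exists N => // n /= Nn; apply: HN => /=; lia.
exact: cvg_comp c2 c1.
Qed.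

Lemma cvg_acoef k : acoef N k @[N --> \oo] --> (Poch q q)^-1 * q ^+ tri k.
Proof.
have E0 := Pochq_neq0.
have -> : (Poch q q)^-1 * q ^+ tri k =
  Poch q q * (Poch q q)^-1 * (Poch q q)^-1 * q ^+ tri k by rewrite mulfV// mul1r.
apply: cvgM; last exact: cvg_cst.
apply: cvgM; last exact: cvg_rinv.
apply: cvgM; last exact: (cvg_rinv (- k)).
have c2 : (fun n : nat => (2 * n)%N) @ \oo --> \oo.
  by move=> P [N _ HN]; exists N => // n /= Nn; apply: HN => /=; lia.
exact: cvg_comp c2 (@poch_cvg R q q0 q1 q).
Qed.

Lemma cvg_acoef_sum (c : int -> C) (D B : R) : 0 <= D -> 0 <= B ->
  (forall k, nm (c k) <= D * B ^+ `|k|%N) ->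
  sumZ (fun k => acoef N k * c k) @[N --> \oo] -->
  sumZ (fun k => (Poch q q)^-1 * q ^+ tri k * c k).
Proof.
move=> D0 B0 hc; have [A A0 hA] := acoef_dom D0 B0.
have ac k : acoef N k * c k @[N --> \oo] --> (Poch q q)^-1 * q ^+ tri k * c k.
  by apply: cvgM; [exact: cvg_acoef|exact: cvg_cst].
have hA' N k : nm (acoef N k * c k) <= A * 2^-1 ^+ `|k|%N by exact: hA.
apply: (@tannery _ _ _ _ (fun N k => acoef N k * c k) _ A 2^-1) => //; try lra.
- by near=> N => k.
- move=> k; apply/ler_addgt0Pr => e e0.
  have [n _ /(_ n (leqnn n)) /= h] := nm_cvg (ac k) e0.
  have := nmD (acoef n k * c k) (- (acoef n k * c k - (Poch q q)^-1 * q ^+ tri k * c k)).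
  by rewrite subKr nmN; have := hA' n k; lra.
Unshelve. all: by end_near. Qed.

Theorem triple_product y : y != 0 ->
  th q y = Poch q q * Poch q (- y) * Poch q (- q / y).
Proof.
move=> y0; have E0 := Pochq_neq0.
have B0 : 0 <= nm y + (nm y)^-1 by rewrite addr_ge0 ?invr_ge0 ?nm_ge0.
have hy k : nm (y ^ k) <= 1 * (nm y + (nm y)^-1) ^+ `|k|%N.
  by rewrite mul1r; exact: nm_exprz.
have := cvg_acoef_sum ler01 B0 hy.
under eq_fun do rewrite triple_product_fin//.
have c2 : poch q (- y) N * poch q (- q / y) N @[N --> \oo] -->
   Poch q (- y) * Poch q (- q / y).
  by apply: cvgM; exact: poch_cvg.
move=> /(norm_cvg_unique c2) h; rewrite -mulrA h.
have [A A0 hA] := @theta_dom R y q 2^-1 y0 q0 q1 ltac:(lra).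
have sy : zsummable (fun k => y ^ k * q ^+ tri k) by exists A, 2^-1; split => //; lra.
have -> : (fun k => (Poch q q)^-1 * q ^+ tri k * y ^ k) =
  (fun k => (Poch q q)^-1 * (y ^ k * q ^+ tri k)) by apply/funext => k; ring.
by rewrite sumZZ// mulrA mulfV// mul1r.
Qed.

Theorem jacobi_cube :
  sumZ (fun k => k%:~R * (- 1) ^ k * q ^+ tri k) = - Poch q q ^+ 3.
Proof.
have E0 := Pochq_neq0.
have hc (k : int) : nm (k%:~R * (- 1) ^ k) <= 1 * 2 ^+ `|k|%N :> R.
  by rewrite mul1r nm_sign_int.
have := cvg_acoef_sum ler01 (ler0n _ 2) hc.
rewrite -(cvg_shiftn 1); under eq_fun do rewrite addn1 triple_product_deriv_fin.
have c2 : - poch q q N * poch q q N.+1 @[N --> \oo] --> - Poch q q * Poch q q.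
  apply: cvgM; first by apply: cvgN; exact: poch_cvg.
  have := @poch_cvg R q q0 q1 q; rewrite -(cvg_shiftn 1).
  by under eq_fun do rewrite addn1.
move=> /(norm_cvg_unique c2) h.
have -> : - Poch q q ^+ 3 = Poch q q * (- Poch q q * Poch q q) by ring.
have [||A A0 hA] := @tri_dom R (nm q) 2 2^-1 _ q1 (ler0n _ 2); rewrite ?nm_gt0 ?invr_gt0//.
have sy : zsummable (fun k => k%:~R * (- 1) ^ k * q ^+ tri k).
  exists A, 2^-1; split; [lra|lra|] => k; apply: le_trans (hA k).
  rewrite nmM nmX mulrC ler_wpM2l ?exprn_ge0 ?nm_ge0//.
  by have := hc k; rewrite mul1r.
rewrite h.
have -> : (fun k : int => (Poch q q)^-1 * q ^+ tri k * (k%:~R * (-1) ^ k)) =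
  (fun k => (Poch q q)^-1 * (k%:~R * (-1) ^ k * q ^+ tri k)) by apply/funext => k; ring.
by rewrite sumZZ// mulrA mulfV// mul1r.
Qed.

End TripleProduct.

(** * The Lerch sum *)

Section PochhammerProducts.
Variables (R : realType) (p : Cplx R).
Hypotheses (p0 : p != 0) (p1 : nm p < 1).
Local Notation C := (Cplx R).

Lemma sqr_neq0 : p ^+ 2 != 0. Proof. by rewrite expf_neq0. Qed.

Lemma sqr_lt1 : nm (p ^+ 2) < 1.
Proof. by rewrite nmX exprn_ilt1 ?nm_ge0. Qed.

Lemma Poch_dissect a : Poch p a = Poch (p ^+ 2) a * Poch (p ^+ 2) (a * p).
Proof.
have E n : poch p a (2 * n) = poch (p ^+ 2) a n * poch (p ^+ 2) (a * p) n.
  elim: n => [|n IH]; first by rewrite !poch0 mulr1.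
  rewrite mulnS add2n !pochS IH -!exprM.
  have -> : p ^+ (2 * n).+1 = p * p ^+ (2 * n) by rewrite exprS.
  ring.
have c2 : (fun n : nat => (2 * n)%N) @ \oo --> \oo.
  by move=> P [N _ HN]; exists N => // n /= Nn; apply: HN => /=; lia.
have c3 := cvg_comp _ _ c2 (@poch_cvg R p p0 p1 a).
have c4 : poch (p ^+ 2) a n * poch (p ^+ 2) (a * p) n @[n --> \oo] -->
    Poch (p ^+ 2) a * Poch (p ^+ 2) (a * p).
  by apply: cvgM; apply: poch_cvg; rewrite ?sqr_neq0 ?sqr_lt1.
have E' : poch p a \o (fun n : nat => (2 * n)%N) =
    (fun n => poch (p ^+ 2) a n * poch (p ^+ 2) (a * p) n).
  by apply/funext => n; exact: E.
by rewrite E' in c3; exact: norm_cvg_unique c3 c4.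
Qed.

Lemma Poch_mulN a : Poch p a * Poch p (- a) = Poch (p ^+ 2) (a ^+ 2).
Proof.
have E n : poch p a n * poch p (- a) n = poch (p ^+ 2) (a ^+ 2) n.
  elim: n => [|n IH]; first by rewrite !poch0 mulr1.
  by rewrite !pochS -IH exprAC; ring.
have c1 : poch p a n * poch p (- a) n @[n --> \oo] --> Poch p a * Poch p (- a).
  by apply: cvgM; apply: poch_cvg.
have := @poch_cvg R (p ^+ 2) sqr_neq0 sqr_lt1 (a ^+ 2).
under eq_fun do rewrite -E.
exact: norm_cvg_unique.
Qed.

End PochhammerProducts.

(** The relation eta(tau/2) eta((tau+1)/2) eta(2 tau) = e^(pi i/24) eta(tau)^3 without its powers of
    q. It expresses (p; p) for p = - q^(1/2), which occurs in the supercharacters, through the eta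
    values of the statement. *)
Lemma Poch_eta (R : realType) (p : Cplx R) : p != 0 -> nm p < 1 ->
  Poch p p * Poch (- p) (- p) * Poch (p ^+ 4) (p ^+ 4) = Poch (p ^+ 2) (p ^+ 2) ^+ 3.
Proof.
move=> p0 p1; set q := p ^+ 2.
have np0 : - p != 0 by rewrite oppr_eq0.
have np1 : nm (- p) < 1 by rewrite nmN.
have q0 := sqr_neq0 p0; have q1 := sqr_lt1 p1.
rewrite (Poch_dissect p0 p1 p) (Poch_dissect np0 np1 (- p)) sqrrN mulrNN -expr2.
have -> : p ^+ 4 = (p ^+ 2) ^+ 2 by rewrite -exprM.
have h := Poch_dissect q0 q1 q; rewrite -[q * q]expr2 in h.
have h2 := Poch_mulN q0 q1 p.
have comb (a b c d e : Cplx R) : a * b * c * d ^+ 2 = e -> a * d * (b * d) * c = e.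
  by move=> <-; ring.
by apply: comb; rewrite h2 -/q -h -exprS.
Qed.

(** The size of [dcoef n] is governed by |n|(|n|+1)/2; this bound and the next make both [dcoef n]
    and [dcoef (n - 1)] of order q^(tri n). *)
Lemma tri_le_bin n : (tri n <= 'C(`|n|.+1, 2))%N.
Proof.
by have := bin2_mul `|n|.+1; have := tri2 n => /=; nia.
Qed.

Lemma tri_le_binB1 n : (tri n <= 'C(`|n - 1|.+1, 2))%N.
Proof.
by have := bin2_mul `|n - 1|.+1; have := tri2 n => /=; nia.
Qed.

(** * The Laurent series of th q y / (1 + y) *)

Section PartialTheta.
Variables (R : realType) (q : Cplx R).
Hypotheses (q0 : q != 0) (q1 : nm q < 1).
Local Notation C := (Cplx R).

(** A one-sided series, padded by 0 so that the tools for two-sided sums apply. *)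
Let dterm (j : nat) (k : int) : C :=
  match k with Posz i => (- 1) ^+ i * q ^+ 'C((j + i).+1, 2) | Negz _ => 0 end.

(* dcoef n = sum_(i >= 0) (-1)^i q^((j+i)(j+i+1)/2) with j = |n|: the solution of
   dcoef n + dcoef (n - 1) = q^(n(n-1)/2) that decays in both directions, i.e.
   the Laurent coefficients of th q y / (1 + y). *)
Definition dcoef (n : int) : C := sumZ (dterm `|n|%N).

Let rho0 : 0 < nm q. Proof. by rewrite nm_gt0. Qed.

Lemma dterm_dom j : gdom (dterm j) (nm q ^+ 'C(j.+1, 2)) (nm q).
Proof.
split => // -[i|i].
  rewrite /= nmM !nmX nmN nm1 expr1n mul1r -exprD ler_wiXn2l ?(ltW q1) ?nm_ge0//.
  have := bin2_mul (j + i).+1; have := bin2_mul j.+1 => /=; nia.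
by rewrite /= nm0 mulr_ge0 ?exprn_ge0 ?nm_ge0.
Qed.

(** Telescoping: term i of the second series is the negative of term i + 1 of the first, and only
    term 0 of the first survives. *)
Lemma dterm_sum j : sumZ (dterm j) + sumZ (dterm j.+1) = q ^+ 'C(j.+1, 2).
Proof.
have s j' : zsummable (dterm j') by exists (nm q ^+ 'C(j'.+1, 2)), (nm q); exact: dterm_dom.
rewrite -(sumZ_shift1 (s j)) -sumZD//; last exact: zsummable_shift.
rewrite -(sumZ_shift (- 1)); last by apply: zsummableD => //; exact: zsummable_shift.
rewrite sumZ_single => [|k k0]; first by rewrite /= addn0 expr0 mul1r addr0.
rewrite subrK; case: k k0 => [[|i]|i] // _.
  have -> : i.+1%:Z - 1 = i by lia.
  by rewrite /= addnS addSn exprS; ring.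
have -> : Negz i - 1 = Negz i.+1 by rewrite !NegzE; lia.
by rewrite /= addr0.
Qed.

Lemma dcoef_rec n : dcoef n + dcoef (n - 1) = q ^+ tri n.
Proof.
rewrite /dcoef; case: n => [[|n]|n].
- by rewrite dterm_sum.
- have -> : `|n.+1%:Z - 1|%N = n by lia.
  by rewrite addrC /= dterm_sum.
- have -> : `|Negz n - 1|%N = `|Negz n|.+1 by lia.
  by rewrite dterm_sum.
Qed.

Lemma nm_dcoef n (m : nat) : (m <= 'C(`|n|.+1, 2))%N ->
  nm (dcoef n) <= 2 / (1 - nm q) * nm q ^+ m.
Proof.
move=> mn; apply: le_trans (nm_sumZ (dterm_dom _)) _.
rewrite mulrAC ler_wpM2l ?divr_ge0 ?subr_ge0 ?(ltW q1)//.
by rewrite ler_wiXn2l ?nm_ge0 ?(ltW q1).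
Qed.

Definition Lsum y : C := sumZ (fun n => dcoef n * y ^ n).

Lemma zsummable_tri (c : int -> C) (K : R) y : 0 <= K -> y != 0 ->
  (forall n, nm (c n) <= K * nm q ^+ tri n) -> zsummable (fun n => c n * y ^ n).
Proof.
move=> K0 y0 hc; have [|A A0 hA] := @theta_dom R y q 2^-1 y0 q0 q1; first lra.
exists (K * A), 2^-1; split; [lra|lra|] => n.
apply: (@le_trans _ _ (K * nm (y ^ n * q ^+ tri n))); last first.
  by rewrite -mulrA ler_wpM2l.
by rewrite !nmM nmX [nm (y ^ n) * _]mulrC mulrA ler_wpM2r ?nm_ge0.
Qed.

Lemma two_div_sub_ge0 : 0 <= 2 / (1 - nm q).
Proof. by rewrite divr_ge0// subr_ge0 ltW. Qed.

Lemma nm_dcoef_tri n : nm (dcoef n) <= 2 / (1 - nm q) * nm q ^+ tri n.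
Proof. exact: nm_dcoef (tri_le_bin n). Qed.

Lemma Lsum_mul y : y != 0 -> (1 + y) * Lsum y = th q y.
Proof.
move=> y0; have s := zsummable_tri two_div_sub_ge0 y0 nm_dcoef_tri.
rewrite /Lsum mulrDl mul1r -sumZZ//.
have s2 := zsummableZ y s.
rewrite -(sumZ_shift (- 1) s2) -sumZD//; last exact: (zsummable_shift (- 1) s2).
congr sumZ; apply/funext => n; rewrite -dcoef_rec expfzDr// -[y ^ (- 1)]/(y^-1).
by field.
Qed.

Lemma Lsum_mulB y : y != 0 ->
  (1 - y) * Lsum y = sumZ (fun n => (dcoef n - dcoef (n - 1)) * y ^ n).
Proof.
move=> y0; have s := zsummable_tri two_div_sub_ge0 y0 nm_dcoef_tri.
rewrite /Lsum mulrBl mul1r -sumZZ//.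
have s2 := zsummableZ y s.
rewrite -(sumZ_shift (- 1) s2) -sumZB//; last exact: (zsummable_shift (- 1) s2).
congr sumZ; apply/funext => n; rewrite expfzDr// -[y ^ (- 1)]/(y^-1).
by field.
Qed.

(** Since th q y = (1 + y) L(y), this value is the derivative of the theta function at -1. It is
    obtained by summing [dcoef_rec] against n (-1)^n and shifting the index in one half. *)
Lemma LsumN1 : Lsum (- 1) = Poch q q ^+ 3.
Proof.
have n10 : (- 1 : C) != 0 by rewrite oppr_eq0 oner_eq0.
rewrite -[RHS]opprK -jacobi_cube//.
have [||A A0 hA] := @tri_dom R (nm q) 2 2^-1 _ q1 (ler0n _ 2); rewrite ?nm_gt0 ?invr_gt0//.
have s0 : zsummable (fun n => dcoef n * (- 1) ^ n)
  := zsummable_tri two_div_sub_ge0 n10 nm_dcoef_tri.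
have s1 : zsummable (fun n => n%:~R * (dcoef n * (- 1) ^ n)).
  exists (2 / (1 - nm q) * A), 2^-1; split; [lra|lra|] => k.
  have -> : k%:~R * (dcoef k * (- 1) ^ k) = dcoef k * (k%:~R * (- 1) ^ k) by ring.
  rewrite nmM; apply: (@le_trans _ _ (2 / (1 - nm q) * nm q ^+ tri k * 2 ^+ `|k|%N)).
    by rewrite ler_pM ?nm_ge0 ?nm_dcoef_tri ?nm_sign_int.
  by rewrite -[leLHS]mulrA -[leRHS]mulrA ler_wpM2l// two_div_sub_ge0.
have s2 := zsummableD s1 s0.
have -> : sumZ (fun k => k%:~R * (- 1) ^ k * q ^+ tri k) =
  sumZ (fun n => n%:~R * (dcoef n * (- 1) ^ n)) -
  sumZ (fun n => n%:~R * (dcoef n * (- 1) ^ n) + dcoef n * (- 1) ^ n).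
  rewrite -(sumZ_shift (- 1) s2) -sumZB//; last exact: (zsummable_shift (- 1) s2).
  congr sumZ; apply/funext => n.
  rewrite -dcoef_rec expfzDr// -[(- 1) ^ (- 1)]/((- 1)^-1) invrN1 rmorphB /=.
  ring.
by rewrite sumZD// /Lsum; ring.
Qed.

Lemma th_quasi y k : y != 0 -> th q y = y ^ k * q ^+ tri k * th q (y * q ^ k).
Proof.
move=> y0; have [|A A0 hA] := @theta_dom R y q 2^-1 y0 q0 q1; first lra.
have sy : zsummable (fun n => y ^ n * q ^+ tri n) by exists A, 2^-1; split; [lra|lra|].
have yq0 : y * q ^ k != 0 by rewrite mulf_neq0// expfz_neq0.
have [|A' A0' hA'] := @theta_dom R (y * q ^ k) q 2^-1 yq0 q0 q1; first lra.
have sy' : zsummable (fun n => (y * q ^ k) ^ n * q ^+ tri n).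
  by exists A', 2^-1; split; [lra|lra|].
rewrite /th -sumZZ// -[LHS](sumZ_shift k sy); congr sumZ; apply/funext => n.
have -> : q ^+ tri (n + k) = q ^+ tri n * q ^+ tri k * (q ^ k) ^ n.
  rewrite exprz_exp !exprnP -!expfzDr//; congr (q ^ _); rewrite triD; lia.
by rewrite expfzDr// exprzMl ?unitfE// ?expfz_neq0//; ring.
Qed.

(** In the triple product, the factors of (-y; q) are the 1 + y q^k with k >= 0, and those of (-q/y;
    q) are, up to units, the ones with k < 0. *)
Lemma th_neq0 y : y != 0 -> (forall k : int, 1 + y * q ^ k != 0) -> th q y != 0.
Proof.
move=> y0 yq; have h0 := Pochq_neq0 q0 q1.
have h1 : Poch q (- y) != 0.
  apply: Poch_neq0 => // i; have := yq i%:Z; rewrite -exprnP; apply: contra => /eqP h.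
  by apply/eqP; rewrite -h; ring.
have h2 : Poch q (- q / y) != 0.
  apply: Poch_neq0 => // i; have := yq (- i.+1%:Z); apply: contra => /eqP h.
  rewrite -exprnN exprS.
  have qi : q ^+ i != 0 by rewrite expf_neq0.
  have -> : 1 + y * (q * q ^+ i)^-1 = y * (q * q ^+ i)^-1 * (1 - - q / y * q ^+ i).
    by field; rewrite q0 qi y0.
  by rewrite h subrr mulr0.
rewrite (triple_product q0 q1 y0) mulf_eq0 mulf_eq0 !negb_or.
by apply/andP; split=> //; apply/andP.
Qed.

Lemma thN1 : th q (- 1) = 0.
Proof.
have n10 : (- 1 : C) != 0 by rewrite oppr_eq0 oner_eq0.
rewrite triple_product// opprK (Poch_split q0 q1 1 1).
by rewrite pochS poch0 expr0 mulr1 subrr !(mulr0, mul0r).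
Qed.

End PartialTheta.

(** * The product of the Lerch sum with a theta function *)

Section CoreIdentity.
Variables (R : realType) (p : Cplx R).
Hypotheses (p0 : p != 0) (p1 : nm p < 1).
Local Notation C := (Cplx R).
Local Notation q := (p ^+ 2).

Let q0 : q != 0 := sqr_neq0 p0.
Let q1 : nm q < 1 := sqr_lt1 p1.

Definition wcoef (c : int -> C) (M : int) : C := c M * (p ^+ tri M)^-1.

Definition pref (x : C) (k : int) : C := x ^ (2 * k) * p ^+ tri (2 * k + 1).

(* For each k, the substitution N = n + 2 k turns the Laurent series of the k-th
   summand into sum_N kern c x k N, where k only enters through N - 2 k. *)
Definition kern c (x : C) (k N : int) : C :=
  x ^ N * p ^+ tri (N + 1) * wcoef c (N - 2 * k).

Section Coefficients.
Variables (c : int -> C) (K : R).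
Hypotheses (K0 : 0 <= K) (hc : forall n, nm (c n) <= K * nm q ^+ tri n).

(** The bound on [c] is p^(2 tri M) in modulus, so dividing by p^(tri M) leaves as much again. *)
Lemma wcoef_dom : exists2 A, 0 <= A & forall M, nm (wcoef c M) <= A * nm p ^+ `|M|%N.
Proof.
have np0 : 0 < nm p by rewrite nm_gt0.
have [A A0 hA] := tri_dom np0 p1 ler01 np0.
exists (K * A) => [|M]; first by rewrite mulr_ge0.
rewrite nmM nmV nmX -mulrA.
apply: le_trans (_ : _ <= K * nm p ^+ tri M) _; last first.
  by rewrite ler_wpM2l//; have := hA M; rewrite expr1n mulr1.
rewrite ler_pdivrMr ?exprn_gt0//; apply: le_trans (hc M) _.
by rewrite nmX -exprM -mulrA -exprD addnn -mul2n.
Qed.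

Lemma kern_dom x : x != 0 -> exists A, forall k N,
  nm (kern c x k N) <= A * nm p ^+ `|k|%N * nm p ^+ `|N|%N.
Proof.
move=> x0; have [B B0 hB] := wcoef_dom.
have np0 : 0 < nm p by rewrite nm_gt0.
have np20 : 0 < nm p ^+ 2 by rewrite exprn_gt0.
(* The rate |p|^2 in N is asked for because 2|N| + |N - 2k| >= |N| + |k| then gives decay in both
   indices. *)
have [A A0 hA] := @theta_dom R (x * p) p _ (mulf_neq0 x0 p0) p0 p1 np20.
exists (A * B) => k N; rewrite /kern.
have -> : x ^ N * p ^+ tri (N + 1) = (x * p) ^ N * p ^+ tri N.
  rewrite exprzMl ?unitfE// -mulrA; congr (_ * _).
  rewrite !exprnP -expfzDr//; congr (p ^ _).
  by rewrite triD (_ : tri 1 = 0%N)//; lia.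
rewrite nmM; apply: le_trans (ler_pM _ _ (hA N) (hB _)) _; rewrite ?nm_ge0//.
have -> : A * (nm p ^+ 2) ^+ `|N| * (B * nm p ^+ absz (N - 2 * k)%R) =
  A * B * (nm p ^+ (2 * `|N| + absz (N - 2 * k)%R)) by rewrite exprD exprM; ring.
rewrite -[leRHS]mulrA -exprD ler_wpM2l ?mulr_ge0// ler_wiXn2l ?nm_ge0 ?(ltW p1)//.
lia.
Qed.

Lemma kern_sum x k : x != 0 ->
  sumZ (kern c x k) = pref x k * sumZ (fun n => c n * (x * p * q ^ k) ^ n).
Proof.
move=> x0; have y0 : x * p * q ^ k != 0 by rewrite !mulf_neq0// expfz_neq0.
have s := zsummable_tri q0 q1 K0 y0 hc.
have sk : zsummable (kern c x k).
  have [A hA] := kern_dom x0.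
  by exists (A * nm p ^+ `|k|%N), (nm p); split; rewrite ?nm_gt0.
rewrite -sumZZ// -(sumZ_shift (2 * k) sk); congr sumZ; apply/funext => n.
rewrite /kern /pref /wcoef addrK.
have xp0 : x * p != 0 by rewrite mulf_neq0.
have tp : p ^+ tri n != 0 by rewrite expf_neq0.
(* By [triD] for n and 2k + 1: the cross term n (2k + 1) produces (p q^k)^n, and p^(tri n) cancels
   the denominator of [wcoef]. *)
have -> : p ^+ tri (n + 2 * k + 1) =
    p ^+ tri n * (p ^+ tri (2 * k + 1) * (p ^ n * (q ^ k) ^ n)).
  rewrite exprz_exp !exprnP exprz_exp -!expfzDr//; congr (p ^ _).
  by rewrite -addrA triD; ring.
rewrite expfzDr// !exprzMl ?unitfE ?mulf_neq0// ?expfz_neq0//.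
by field.
Qed.

Lemma kern_zsummable x : x != 0 ->
  zsummable (fun k => pref x k * sumZ (fun n => c n * (x * p * q ^ k) ^ n)).
Proof.
move=> x0; have [A hA] := kern_dom x0.
under eq_fun do rewrite -kern_sum//.
by apply: zsummable_sumZ hA; rewrite ?nm_gt0.
Qed.

Lemma kern_fubini x : x != 0 ->
  sumZ (fun k => pref x k * sumZ (fun n => c n * (x * p * q ^ k) ^ n)) =
  sumZ (fun N => x ^ N * p ^+ tri (N + 1) * sumZ (fun k => wcoef c (N - 2 * k))).
Proof.
move=> x0; have [A hA] := kern_dom x0.
under eq_fun do rewrite -kern_sum//.
rewrite (sumZ_fubini _ p1 hA) ?nm_gt0//.
congr sumZ; apply/funext => N.
rewrite sumZZ//.
have [B B0 hB] := wcoef_dom.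
have sw : zsummable (wcoef c) by exists B, (nm p); split; rewrite ?nm_gt0.
apply: zsummable_ext (zsummable_even (zsummable_rev (zsummable_shift (N + 1) sw))) => k.
by congr wcoef; lia.
Qed.

End Coefficients.

(** The Laurent coefficients of (1 - y) L(y). *)
Let e n := dcoef q n - dcoef q (n - 1).

Let Kge0' : 0 <= 2 * (2 / (1 - nm q)).
Proof. by rewrite mulr_ge0// two_div_sub_ge0. Qed.

Let e_dom n : nm (e n) <= 2 * (2 / (1 - nm q)) * nm q ^+ tri n.
Proof.
apply: le_trans (nmD _ _) _; rewrite nmN.
have := nm_dcoef q0 q1 (tri_le_bin n); have := nm_dcoef q0 q1 (tri_le_binB1 n).
lra.
Qed.

Let e_sym (n : int) : e (1 - n) = - e n.
Proof.
rewrite /e /dcoef.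
have -> : absz (1 - n - 1)%R = absz n by lia.
have -> : absz (1 - n)%R = absz (n - 1)%R by lia.
by rewrite opprB.
Qed.

Let W := sumZ (fun k => wcoef e (2 * k)).

Let sw : zsummable (wcoef e).
Proof.
have [B B0 hB] := wcoef_dom Kge0' e_dom.
by exists B, (nm p); split; rewrite ?nm_gt0.
Qed.

(** The sum runs over the indices with the parity of N. The map n -> 1 - n exchanges the two
    parities, fixes [tri] and negates [e], so the odd sum is minus the even one. *)
Let W_parity N : sumZ (fun k => wcoef e (N - 2 * k)) = (- 1) ^ N * W.
Proof.
have n10 : (- 1 : C) != 0 by rewrite oppr_eq0 oner_eq0.
have ev a : (- 1) ^ (2 * a) = 1 :> C by rewrite -exprz_exp -exprnP sqrrN expr1n exp1rz.
have [a [->|->]] : exists a : int, N = 2 * a \/ N = 2 * a + 1.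
  case: N => n; first by exists n./2; case: (boolP (odd n)) => o;
    [right|left]; have := odd_double_half n; rewrite -mul2n ?o ?(negbTE o); lia.
  exists (- n./2%:Z - 1); rewrite NegzE; case: (boolP (odd n)) => o;
    [left|right]; have := odd_double_half n; rewrite -mul2n ?o ?(negbTE o); lia.
- rewrite ev mul1r /W -[RHS](sumZ_reflect a (zsummable_even sw)).
  by congr sumZ; apply/funext => k; congr wcoef; lia.
- rewrite expfzDr// ev expr1z mul1r mulN1r /W -(sumZ_reflect 0 (zsummable_even sw)).
  rewrite -sumZN; last first.
    apply: zsummable_ext (zsummable_rev (zsummable_shift 1 (zsummable_even sw))) => k.
    by congr wcoef; lia.
  rewrite -[LHS](sumZ_reflect a); last first.
    apply: zsummable_ext (zsummable_even (zsummable_rev (zsummable_shift (2 * a + 2) sw))) => k.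
    by congr wcoef; lia.
  congr sumZ; apply/funext => k; rewrite /wcoef.
  have -> : 2 * a + 1 - 2 * (a - k) = 1 - 2 * (0 - k) by lia.
  by rewrite e_sym tri1B mulNr.
Qed.

Let core_aux x : x != 0 ->
  sumZ (fun k => pref x k * ((1 - x * p * q ^ k) * Lsum q (x * p * q ^ k))) =
  W * th p (- (x * p)).
Proof.
move=> x0; have xp0 : x * p != 0 by rewrite mulf_neq0.
have -> : (fun k => pref x k * ((1 - x * p * q ^ k) * Lsum q (x * p * q ^ k))) =
   (fun k => pref x k * sumZ (fun n => e n * (x * p * q ^ k) ^ n)).
  apply/funext => k; congr (_ * _); apply: Lsum_mulB => //.
  by rewrite !mulf_neq0// expfz_neq0.
rewrite (kern_fubini Kge0' e_dom x0).
have nxp : - (x * p) != 0 by rewrite oppr_eq0.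
have [|A A0 hA] := @theta_dom R (- (x * p)) p 2^-1 nxp p0 p1; first lra.
rewrite /th -sumZZ; last by exists A, 2^-1; split; [lra|lra|].
congr sumZ; apply/funext => N; rewrite W_parity.
have -> : p ^+ tri (N + 1) = p ^ N * p ^+ tri N.
  rewrite !exprnP -expfzDr//; congr (p ^ _).
  by rewrite triD (_ : tri 1 = 0%N)//; lia.
have -> : (- (x * p)) ^ N = (- 1) ^ N * (x ^ N * p ^ N).
  by rewrite -exprzMl ?unitfE// -exprzMl ?unitfE ?mulN1r// oppr_eq0 oner_eq0.
by move: W => w; ring.
Qed.

(* At x = - 1 / p only the summand k = 0 survives. *)
Let W_val : W = Poch q q * Poch p p.
Proof.
have n10 : (- 1 : C) != 0 by rewrite oppr_eq0 oner_eq0.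
have x0 : - p^-1 != 0 by rewrite oppr_eq0 invr_eq0.
have := core_aux x0.
have xp : - p^-1 * p = - 1 by rewrite mulNr mulVf.
rewrite xp opprK sumZ_single => [|k k0]; last first.
  (* By quasi-periodicity the theta function vanishes at all - q^k, and for k != 0 the factor 1 -
     q^k does not. *)
  suff -> : Lsum q (- 1 * q ^ k) = 0 by rewrite !mulr0.
  have y0 : - 1 * q ^ k != 0 by rewrite mulf_neq0// expfz_neq0.
  have : (1 - q ^ k) * Lsum q (- 1 * q ^ k) = 0.
    have := Lsum_mul q0 q1 y0; rewrite mulN1r => ->.
    have /esym/eqP := th_quasi q0 q1 k n10; rewrite thN1// mulN1r.
    by rewrite !mulf_eq0 (negbTE (expfz_neq0 _ n10)) (negbTE (expf_neq0 _ q0)) => /eqP.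
  move=> /eqP; rewrite mulf_eq0 => /orP[|/eqP//].
  rewrite subr_eq0 => /eqP /(congr1 (@nm R)); rewrite nmXz nm1 => h; exfalso.
  have nq0 : 0 < nm q by rewrite nm_gt0.
  have lt1 (n : nat) : nm q ^+ n.+1 < 1 by rewrite exprn_ilt1// nm_ge0.
  case: k k0 h {y0} => [[|n]|n]// _ h.
    by have := lt1 n; rewrite exprnP -h ltxx.
  by have := lt1 n; rewrite -[nm q ^+ _]invrK exprnN -NegzE -h invr1 ltxx.
(* The summand k = 0 equals 2 (q; q)^3. On the other side th p 1 contains (-1; p) = 2 (-p; p), and
   (p; p)(-p; p) = (q; q) then determines W. *)
rewrite /pref mulr0 !expr0z add0r (_ : tri 1 = 0%N)// expr0 !mulr1 mul1r opprK LsumN1//.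
rewrite (triple_product p0 p1) ?oner_eq0// divr1 (Poch_split p0 p1 (- 1) 1).
rewrite pochS poch0 expr0 mul1r mulr1 expr1 mulN1r opprK => h.
have h2 : Poch p p * Poch p (- p) = Poch q q by rewrite Poch_mulN.
have E0 : Poch q q != 0 := Pochq_neq0 q0 q1.
apply: (mulIf (expf_neq0 2 E0)).
have two0 : (1 + 1 : C) != 0 by rewrite -[1 + 1]/(2%:R) pnatr_eq0.
apply: (mulfI two0).
transitivity (Poch p p * (W * (Poch p p * ((1 + 1) * Poch p (- p)) * Poch p (- p)))).
  by rewrite -h2; ring.
by rewrite -h; move: (Poch q q) (Poch p p) => a b; ring.
Qed.

(* Multiplying the k-th summand by th q (x p), rewritten with the
   quasi-periodicity, cancels its pole. *)
Lemma th_mul_term x k : x != 0 ->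
  th q (x * p) * (x ^ k * q ^+ tri (k + 1)) =
  pref x k * ((1 + x * p * q ^ k) * Lsum q (x * p * q ^ k)).
Proof.
move=> x0; have xp0 : x * p != 0 by rewrite mulf_neq0.
have y0 : x * p * q ^ k != 0 by rewrite mulf_neq0// expfz_neq0.
rewrite (Lsum_mul q0 q1 y0) (th_quasi q0 q1 k xp0) /pref.
have -> : p ^+ tri (2 * k + 1) = p ^ k * q ^+ tri k * q ^+ tri (k + 1).
  rewrite -!exprM !exprnP -!expfzDr//; congr (p ^ _).
  by have := tri2 (2 * k + 1); have := tri2 k; have := tri2 (k + 1); lia.
have -> : x ^ (2 * k) = x ^ k * x ^ k by rewrite -expfzDr//; congr (x ^ _); lia.
by rewrite exprzMl ?unitfE//; ring.
Qed.

Lemma zsummable_xq x : x != 0 ->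
  zsummable (fun k => x ^ k * q ^+ tri (k + 1)).
Proof.
move=> x0.
have y0 : x * q != 0 by rewrite mulf_neq0.
have [|A A0 hA] := @theta_dom R (x * q) q 2^-1 y0 q0 q1; first lra.
exists A, 2^-1; split; [lra|lra|] => k; apply: le_trans (hA k).
rewrite exprzMl ?unitfE// -mulrA; rewrite le_eqVlt; apply/orP; left; apply/eqP.
congr (nm (_ * _)); rewrite !exprnP -expfzDr//; congr (_ ^ _).
by rewrite triD (_ : tri 1 = 0%N)//; lia.
Qed.

Section Poles.
Variable x : C.
Hypotheses (x0 : x != 0) (hx : forall k : int, 1 + x * p * q ^ k != 0).

Let th0 : th q (x * p) != 0.
Proof. by apply: th_neq0 => //; rewrite mulf_neq0. Qed.

(** By [th_mul_term] the summand is a fixed multiple of the entry [pref x k] times a value of L,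
    whose summability is known; no lower bound on the denominators is required. *)
Lemma zsummable_lerch :
  zsummable (fun k => x ^ k * q ^+ tri (k + 1) / (1 + x * p * q ^ k)).
Proof.
have := kern_zsummable (two_div_sub_ge0 q1) (nm_dcoef_tri q0 q1) x0.
move=> /(zsummableZ (th q (x * p))^-1); apply: zsummable_ext => k.
have := th_mul_term k x0; rewrite /Lsum => h.
apply: (mulfI th0); rewrite [LHS]mulrA mulfV// mul1r [RHS]mulrA h.
by rewrite -[RHS]mulrA; congr (_ * _); rewrite [RHS]mulrC mulKf ?hx.
Qed.

Lemma core_identity :
  th q (x * p) * Poch q q *
    sumZ (fun k => x ^ k * q ^+ tri (k + 1) * (1 - x * p * q ^ k) / (1 + x * p * q ^ k))
  = Poch p p ^+ 2 * (th q (- (x * p)) * th q (- (x * q))).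
Proof.
have xp0 : x * p != 0 by rewrite mulf_neq0.
have aux : th q (x * p) *
    sumZ (fun k => x ^ k * q ^+ tri (k + 1) * (1 - x * p * q ^ k) / (1 + x * p * q ^ k))
  = Poch q q * Poch p p * th p (- (x * p)).
  rewrite -W_val -core_aux// -sumZZ; last first.
    (* Uses (1 - v) / (1 + v) = 2 / (1 + v) - 1. *)
    have s2 := zsummableD (zsummableZ 2 zsummable_lerch) (zsummableN (zsummable_xq x0)).
    apply: zsummable_ext s2 => k.
    by field; exact: hx.
  congr sumZ; apply/funext => k.
  have := th_mul_term k x0 => h.
  apply: (mulIf (hx k)).
  transitivity (th q (x * p) * (x ^ k * q ^+ tri (k + 1)) * (1 - x * p * q ^ k)).
    by field; exact: hx.
  by rewrite h; ring.
have nxp : - (x * p) != 0 by rewrite oppr_eq0.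
have nxq : - (x * q) != 0 by rewrite oppr_eq0 mulf_neq0.
have E0 : Poch q q != 0 := Pochq_neq0 q0 q1.
have t1 := triple_product p0 p1 nxp.
have t2 := triple_product q0 q1 nxp.
have t3 := triple_product q0 q1 nxq.
have e1 : - p / - (x * p) = x^-1 by rewrite invrN mulrNN invfM mulrCA mulfV// mulr1.
have e2 : - q / - (x * p) = x^-1 * p.
  by rewrite invrN mulrNN invfM mulrCA expr2 mulfK.
have e3 : - q / - (x * q) = x^-1 by rewrite invrN mulrNN invfM mulrCA mulfV// mulr1.
have e4 : x * p * p = x * q by rewrite -mulrA -expr2.
(* Splitting (x p; p) and (1/x; p) into even and odd factors gives four products with base q, which
   regroup into the two theta functions. *)
rewrite opprK e1 (Poch_dissect p0 p1 (x * p)) (Poch_dissect p0 p1 x^-1) e4 in t1.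
rewrite opprK e2 in t2; rewrite opprK e3 in t3.
have comb (T S T1 T2 T3 a b c d e' f : C) : T * S = a * b * T1 ->
    T1 = b * (c * d) * (e' * f) -> T2 = a * c * f -> T3 = a * d * e' ->
    T * a * S = b ^+ 2 * (T2 * T3).
  by move=> h1 h2 h3 h4; rewrite mulrAC h1 h2 h3 h4; ring.
exact: comb aux t1 t2 t3.
Qed.

End Poles.

End CoreIdentity.

(** * Theta functions and characters *)

Section Exponential.
Variable R : realType.
Local Notation C := (Cplx R).
Implicit Types x y : C.

Lemma e2piE x : e2pi x = (expR (- (2 * pi * complex.Im x)))%:C *
  (cos (2 * pi * complex.Re x) +i* sin (2 * pi * complex.Re x)).
Proof.
case: x => a b; rewrite /e2pi /cexp.
have -> : 2 * (pi%:C : C) * 'i * (a +i* b) = (- (2 * pi * b)) +i* (2 * pi * a) :> C.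
  have -> : (2 : C) = 2 +i* 0 by rewrite -[2 in RHS]/(1 + 1) -[0 in RHS]addr0.
  by apply/eqP; rewrite eq_complex /=; apply/andP; split; apply/eqP; ring.
by [].
Qed.

Lemma e2piD x y : e2pi (x + y) = e2pi x * e2pi y.
Proof.
rewrite !e2piE; case: x y => [a b] [c d].
rewrite -[(a +i* b) + (c +i* d)]/((a + c) +i* (b + d)) [complex.Re _]/= [complex.Im _]/=.
rewrite mulrACA -rmorphM -expRD; congr (_%:C * _).
  by congr expR; rewrite !mulrDr opprD.
by rewrite /= !mulrDr cosD sinD; apply/eqP; rewrite eq_complex /=;
  apply/andP; split; apply/eqP; ring.
Qed.

Lemma e2pi0 : e2pi (0 : C) = 1.
Proof. by rewrite e2piE /= !mulr0 oppr0 expR0 cos0 sin0 mul1r. Qed.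

Lemma e2pi_neq0 x : e2pi x != 0.
Proof.
apply/eqP => h; have := e2pi0; rewrite -(subrr x) e2piD h mul0r => /eqP.
by rewrite eq_sym oner_eq0.
Qed.

Lemma e2piN x : e2pi (- x) = (e2pi x)^-1.
Proof.
by apply: (mulfI (e2pi_neq0 x)); rewrite -e2piD subrr e2pi0 mulfV// e2pi_neq0.
Qed.

Lemma e2pi_mulz (k : int) x : e2pi (k%:~R * x) = e2pi x ^ k.
Proof.
have P (n : nat) y : e2pi (n%:R * y) = e2pi y ^+ n.
  elim: n => [|n IH]; first by rewrite mul0r e2pi0 expr0.
  by rewrite -natr1 mulrDl mul1r e2piD IH exprSr.
case: k => n; first by rewrite -pmulrn P.
by rewrite NegzE -exprnN mulrNz mulNr e2piN -pmulrn P.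
Qed.

Lemma nm_e2pi x : nm (e2pi x) = expR (- (2 * pi * complex.Im x)).
Proof.
rewrite e2piE nmM.
have -> (r : R) : nm (r%:C) = `|r|.
  by apply: (@complexI R); rewrite -normE normc_def /= expr0n addr0 sqrtr_sqr.
rewrite ger0_norm ?expR_ge0//.
have -> (r : R) : nm (cos r +i* sin r) = 1.
  by rewrite /nm /= cos2Dsin2 sqrtr1.
by rewrite mulr1.
Qed.

Lemma e2pi_half : e2pi (2^-1 : C) = - 1.
Proof.
have -> : (2^-1 : C) = (2^-1)%:C by rewrite fmorphV rmorph_nat.
rewrite e2piE /= mulr0 oppr0 expR0 mul1r.
have -> : 2 * pi / 2 = pi :> R by field.
by rewrite cospi sinpi; apply/eqP; rewrite eq_complex /= oppr0 !eqxx.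
Qed.

Lemma e2pi1 : e2pi (1 : C) = 1.
Proof.
have h : 2^-1 + 2^-1 = 1 :> C by field.
by rewrite -[X in e2pi X]h e2piD e2pi_half mulrNN mulr1.
Qed.

Lemma e2pi_quarter : e2pi (4^-1 : C) = 'i.
Proof.
have -> : (4^-1 : C) = (4^-1)%:C by rewrite fmorphV rmorph_nat.
rewrite e2piE /= mulr0 oppr0 expR0 mul1r.
have -> : 2 * pi / 4 = pi / 2 :> R by field.
by rewrite cos_pihalf sin_pihalf.
Qed.

(** The cosine is even and injective on [0, pi], and the bound places |2 pi Re x| there. *)
Lemma e2pi_eq1 x : complex.Im x = 0 -> `|complex.Re x| < 2^-1 -> e2pi x = 1 -> x = 0.
Proof.
case: x => a b /= -> ha; rewrite e2piE /= mulr0 oppr0 expR0 mul1r => -[hc _].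
have pi0 := pi_gt0 R.
have : `|2 * pi * a| = 0.
  apply: (@cos_inj R); rewrite ?in_itv /= ?normr_ge0 ?lexx ?pi_ge0//=.
    rewrite normrM ger0_norm ?mulr_ge0 ?pi_ge0//.
    have := normr_ge0 a; nra.
  by rewrite cos0; case: (ler0P (2 * pi * a)); rewrite ?cosN.
move=> /eqP; rewrite normr_eq0 mulf_eq0 => /orP[|/eqP->//].
by rewrite mulf_eq0 pnatr_eq0 /= gt_eqF.
Qed.

Lemma ReB x y : complex.Re (x - y) = complex.Re x - complex.Re y.
Proof. by case: x y => [a b] [c d]. Qed.

Lemma ImB x y : complex.Im (x - y) = complex.Im x - complex.Im y.
Proof. by case: x y => [a b] [c d]. Qed.

Lemma cvg_e2pi {T} {F : set_system T} {FF : Filter F} (f : T -> C) (z : C) :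
  f t @[t --> F] --> z -> e2pi (f t) @[t --> F] --> e2pi z.
Proof.
move=> cf.
have cRe : complex.Re (f t) @[t --> F] --> complex.Re z.
  apply/cvgrPdist_le => e e0.
  apply: filterS (nm_cvg cf e0) => t h.
  by rewrite distrC -ReB; exact: le_trans (nm_Re _) h.
have cIm : complex.Im (f t) @[t --> F] --> complex.Im z.
  apply/cvgrPdist_le => e e0.
  apply: filterS (nm_cvg cf e0) => t h.
  by rewrite distrC -ImB; exact: le_trans (nm_Im _) h.
pose E (w : C) := expR (- (2 * pi * complex.Im w)).
pose A (w : C) := E w * cos (2 * pi * complex.Re w).
pose B (w : C) := E w * sin (2 * pi * complex.Re w).
have cE : E (f w) @[w --> F] --> E z.
  apply: (cvg_comp (fun w => - (2 * pi * complex.Im (f w))) expR); last exact: continuous_expR.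
  by apply: cvgN; apply: cvgM => //; exact: cvg_cst.
have cS : 2 * pi * complex.Re (f w) @[w --> F] --> 2 * pi * complex.Re z.
  by apply: cvgM => //; exact: cvg_cst.
have cA : A (f w) @[w --> F] --> A z.
  by apply: cvgM => //; apply: (cvg_comp _ cos cS); exact: continuous_cos.
have cB : B (f w) @[w --> F] --> B z.
  by apply: cvgM => //; apply: (cvg_comp _ sin cS); exact: continuous_sin.
have EAB w : e2pi w = A w +i* B w.
  rewrite e2piE; apply/eqP; rewrite eq_complex /=.
  by apply/andP; split; apply/eqP; rewrite /A /B /E; ring.
apply: cvg_nm => e e0.
have e20 : 0 < e / 2 by lra.
near=> w; rewrite !EAB; apply: le_trans (nm_le _) _.
have -> : e = e / 2 + e / 2 by lra.
rewrite /=; apply: lerD; rewrite distrC; near: w.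
  by move/cvgrPdist_le: cA; apply.
by move/cvgrPdist_le: cB; apply.
Unshelve. all: by end_near. Qed.

End Exponential.

(** * Theta and eta in terms of [th] and [Poch] *)

Section Translation.
Variable R : realType.
Local Notation C := (Cplx R).
Variable tau : C.
Local Notation q := (e2pi tau).

Lemma q_lt1 : 0 < complex.Im tau -> nm q < 1.
Proof.
move=> h; rewrite nm_e2pi expR_lt1 oppr_lt0 !mulr_gt0 ?pi_gt0//.
Qed.

Lemma intr_sqr_tri (n : int) : (n%:~R : C) ^+ 2 = 2 * ((tri n)%:Z)%:~R + n%:~R.
Proof.
rewrite -[2]/(2%:Z%:~R) -intrM tri2 -intrD -[RHS]/((_ : int)%:~R) expr2 -intrM.
by congr _%:~R; lia.
Qed.

(** As n^2 / 2 = tri n + n / 2, passing from squares to triangular numbers shifts the argument by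
    tau / 2. *)
Lemma e2pi_gauss (n : int) (y : C) :
  e2pi (tau * n%:~R ^+ 2 / 2 + n%:~R * y) = (e2pi (y + tau / 2)) ^ n * q ^+ tri n.
Proof.
rewrite -e2pi_mulz [q ^+ _]exprnP -e2pi_mulz -e2piD; congr e2pi.
by rewrite intr_sqr_tri; field.
Qed.

Lemma theta00E z : theta 0 0 tau z = th q (e2pi z * e2pi (tau / 2)).
Proof.
rewrite /theta /th; congr sumZ; apply/funext => n.
have -> : tau * (n%:~R + 0%:R / 2) ^+ 2 / 2 + (n%:~R + 0%:R / 2) * (z + 0%:R / 2) =
  tau * n%:~R ^+ 2 / 2 + n%:~R * z by field.
rewrite (e2pi_gauss n z) (e2piD z); reflexivity.
Qed.

Lemma theta01E z : theta 0 1 tau z = th q (- (e2pi z * e2pi (tau / 2))).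
Proof.
rewrite /theta /th; congr sumZ; apply/funext => n.
have -> : tau * (n%:~R + 0%:R / 2) ^+ 2 / 2 + (n%:~R + 0%:R / 2) * (z + 1%:R / 2) =
  tau * n%:~R ^+ 2 / 2 + n%:~R * (z + 2^-1) by field.
rewrite (e2pi_gauss n (z + 2^-1)).
rewrite [z + 2^-1 + _]addrAC (e2piD _ 2^-1) (e2piD z) e2pi_half mulrN1; reflexivity.
Qed.

Lemma theta11E z : zsummable (fun n => (- (e2pi z * q)) ^ n * q ^+ tri n) ->
  theta 1 1 tau z =
  e2pi (tau / 8 + z / 2 + 4^-1) * th q (- (e2pi z * q)).
Proof.
move=> s; rewrite /theta /th -sumZZ//; congr sumZ; apply/funext => n.
have -> : - (e2pi z * q) = e2pi (z + tau + 2^-1) by rewrite !e2piD e2pi_half; ring.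
rewrite -e2pi_mulz [q ^+ _]exprnP -e2pi_mulz -!e2piD; congr e2pi.
have -> : tau * (n%:~R + 1%:R / 2) ^+ 2 / 2 = tau * n%:~R ^+ 2 / 2 + n%:~R * (tau / 2) + tau / 8.
  by field.
by rewrite intr_sqr_tri; field.
Qed.

Lemma etaE : eta tau = e2pi (tau / 24) * Poch q q.
Proof.
have E : (fun N : nat => \prod_(1 <= n < N.+1) (1 - e2pi (n%:R * tau))) = poch q q.
  apply/funext => N; rewrite /poch big_add1 /= big_mkord; apply: eq_bigr => i _.
  by rewrite -exprS exprnP -(e2pi_mulz i.+1%:Z tau) -pmulrn.
rewrite /eta E; reflexivity.
Qed.

End Translation.

(** * Reassembling series from their even and odd terms *)

Section ParityCombination.
Variable R : realType.
Local Notation C := (Cplx R).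
Implicit Types f g h : int -> C.

Lemma sumZ_odd_rev f : sumZ (fun j => f (- 1 - 2 * j)) = sumZ (fun j => f (2 * j + 1)).
Proof.
rewrite -sumZ_rev; congr sumZ; apply/funext => j; congr f; lia.
Qed.

(** The four series stand for Phi1 and Phi2 at m2 = 0, then at m2 = 2: even indices come from Phi1,
    odd ones from Phi2. *)
Lemma parity_sum g h : zsummable g -> zsummable h ->
  sumZ (fun j => g (2 * j)) - sumZ (fun j => h (- 1 - 2 * j)) +
  (sumZ (fun j => - h (2 * j)) - sumZ (fun j => - g (- 1 - 2 * j))) =
  sumZ (fun k => g k - h k).
Proof.
move=> sg sh.
rewrite (sumZN (zsummable_even sh)).
have -> : sumZ (fun j => - g (- 1 - 2 * j)) = - sumZ (fun j => g (2 * j + 1)).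
  by rewrite -(sumZN (zsummable_odd sg)) (sumZ_odd_rev (fun k => - g k)).
rewrite sumZ_odd_rev (sumZB sg sh) -(sumZ_parity sg) -(sumZ_parity sh).
ring.
Qed.

Lemma parity_diff g h f : zsummable g -> zsummable h -> zsummable f ->
  (forall k, f k = g k + h k) ->
  sumZ (fun j => g (2 * j)) - sumZ (fun j => h (- 1 - 2 * j)) -
  (sumZ (fun j => - h (2 * j)) - sumZ (fun j => - g (- 1 - 2 * j))) =
  sumZ (fun k => (- 1) ^ k * f k).
Proof.
move=> sg sh sf fgh.
have n10 : (- 1 : C) != 0 by rewrite oppr_eq0 oner_eq0.
have ev a : (- 1) ^ (2 * a) = 1 :> C by rewrite -exprz_exp -exprnP sqrrN expr1n exp1rz.
have s1 : zsummable (fun k => (- 1) ^ k * f k).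
  have [A [r [r0 r1 hA]]] := sf; exists A, r; split => // k.
  by rewrite nmM nmXz nmN nm1 exp1rz mul1r.
rewrite (sumZN (zsummable_even sh)).
have -> : sumZ (fun j => - g (- 1 - 2 * j)) = - sumZ (fun j => g (2 * j + 1)).
  by rewrite -(sumZN (zsummable_odd sg)) (sumZ_odd_rev (fun k => - g k)).
rewrite sumZ_odd_rev -(sumZ_parity s1).
have -> : (fun k : int => (- 1) ^ (2 * k) * f (2 * k)) = (fun k => g (2 * k) + h (2 * k)).
  by apply/funext => k; rewrite ev mul1r fgh.
have -> : (fun k : int => (- 1) ^ (2 * k + 1) * f (2 * k + 1)) =
    (fun k => - (g (2 * k + 1) + h (2 * k + 1))).
  by apply/funext => k; rewrite expfzDr// ev expr1z mul1r mulN1r fgh.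
rewrite sumZN; last exact: (zsummableD (zsummable_odd sg) (zsummable_odd sh)).
rewrite (sumZD (zsummable_even sg) (zsummable_even sh)).
rewrite (sumZD (zsummable_odd sg) (zsummable_odd sh)).
ring.
Qed.

(** Carries the outer factor of Phi into the series; summability of [f] is inherited from [g], as
    [c] is invertible. *)
Lemma mul_sumZ_eq (c l : C) f g : c != 0 -> zsummable g ->
  (forall j, c * f j = l * g j) -> c * sumZ f = l * sumZ g.
Proof.
move=> c0 sg H.
have -> : f = fun j => c^-1 * l * g j.
  by apply/funext => j; rewrite -mulrA -H mulKf.
by rewrite (sumZZ _ sg) -!mulrA mulVKf.
Qed.

End ParityCombination.

Section PhiSums.
Variables (R : realType) (tau u z : Cplx R).
Local Notation C := (Cplx R).
Local Notation X := (e2pi z).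
Local Notation P := (e2pi u).
Local Notation q := (e2pi tau).
Local Notation lam := (e2pi ((z + u) / 2 - tau / 8)).

Lemma tri_odd_intr (j : int) : ((tri (2 * j + 1))%:Z)%:~R = 2 * j%:~R ^+ 2 + j%:~R :> C.
Proof.
have -> : (tri (2 * j + 1))%:Z = 2 * (j * j) + j by have := tri2 (2 * j + 1); lia.
by rewrite intrD !intrM expr2.
Qed.

(** Since 2j^2 + j = tri (2j + 1), this is the term k = 2j of x^k q^(k(k+1)/2). *)
Lemma Phi1_num0 (j : int) :
  e2pi (- 1 * (tau / 8)) *
  (e2pi (1 * j%:~R * ((z + u) + (z - u)) + (0%:R + 1) / 2 * (z + u)) *
   e2pi (2 * tau * (1 * j%:~R ^+ 2 + (0%:R + 1) / 2 * j%:~R))) =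
  lam * (X ^ (2 * j) * q ^+ tri (2 * j + 1)).
Proof.
rewrite -(e2pi_mulz (2 * j) z) [q ^+ _]exprnP -(e2pi_mulz _ tau) -!e2piD tri_odd_intr intrM.
by congr e2pi; field.
Qed.

Lemma Phi1_num2 (j : int) :
  e2pi (- 1 * (tau / 8)) *
  (e2pi (1 * j%:~R * ((z + u) + (z - u)) + (2%:R + 1) / 2 * (z + u)) *
   e2pi (2 * tau * (1 * j%:~R ^+ 2 + (2%:R + 1) / 2 * j%:~R))) =
  lam * (X ^ (2 * j) * q ^+ tri (2 * j + 1) * (X * P * q ^ (2 * j))).
Proof.
rewrite -(e2pi_mulz (2 * j) z) [q ^+ _]exprnP -(e2pi_mulz _ tau) -(e2pi_mulz (2 * j) tau).
rewrite -!e2piD tri_odd_intr intrM.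
by congr e2pi; field.
Qed.

(** The same series at the odd index k = - 1 - 2j, by the symmetry [tri1B]. *)
Lemma Phi2_num0 (j : int) :
  e2pi (- 1 * (tau / 8)) *
  (e2pi (- 1 * j%:~R * ((z + u) + (z - u)) - (0%:R + 1) / 2 * (z - u)) *
   e2pi (2 * tau * (1 * j%:~R ^+ 2 + (0%:R + 1) / 2 * j%:~R))) =
  lam * (X ^ (- 1 - 2 * j) * q ^+ tri (- 1 - 2 * j + 1)).
Proof.
have -> : tri (- 1 - 2 * j + 1) = tri (2 * j + 1) by rewrite -tri1B; congr tri; lia.
rewrite -(e2pi_mulz (- 1 - 2 * j) z) [q ^+ _]exprnP -(e2pi_mulz _ tau) -!e2piD tri_odd_intr.
rewrite intrB intrN intrM.
by congr e2pi; field.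
Qed.

Lemma Phi2_num2 (j : int) :
  e2pi (- 1 * (tau / 8)) *
  (e2pi (- 1 * j%:~R * ((z + u) + (z - u)) - (2%:R + 1) / 2 * (z - u)) *
   e2pi (2 * tau * (1 * j%:~R ^+ 2 + (2%:R + 1) / 2 * j%:~R))) =
  lam * (X ^ (- 1 - 2 * j) * q ^+ tri (- 1 - 2 * j + 1) * (X^-1 * P * q ^ (2 * j))).
Proof.
have -> : tri (- 1 - 2 * j + 1) = tri (2 * j + 1) by rewrite -tri1B; congr tri; lia.
rewrite -(e2pi_mulz (- 1 - 2 * j) z) [q ^+ _]exprnP -(e2pi_mulz _ tau) -(e2pi_mulz (2 * j) tau).
rewrite -(e2piN z) -!e2piD tri_odd_intr intrB intrN intrM.
by congr e2pi; field.
Qed.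

Lemma Phi1_den (j : int) :
  1 - e2pi (z + u) * e2pi (j%:~R * (2 * tau)) = 1 + X * - P * q ^ (2 * j).
Proof.
have -> : j%:~R * (2 * tau) = (2 * j)%:~R * tau by rewrite intrM; ring.
by rewrite e2pi_mulz e2piD mulrN mulNr.
Qed.

Lemma Phi2_den (j : int) :
  1 - e2pi (- (z - u)) * e2pi (j%:~R * (2 * tau)) = 1 - X^-1 * P * q ^ (2 * j).
Proof.
have -> : j%:~R * (2 * tau) = (2 * j)%:~R * tau by rewrite intrM; ring.
have -> : - (z - u) = - z + u by ring.
by rewrite e2pi_mulz e2piD e2piN.
Qed.

End PhiSums.

Section PhiLerch.
Variables (R : realType) (tau u z : Cplx R).
Local Notation C := (Cplx R).
Hypothesis htau : 0 < complex.Im tau.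
Hypothesis hu : e2pi (2 * u) = e2pi tau.
Local Notation X := (e2pi z).
Local Notation p := (- e2pi u).
Local Notation lam := (e2pi ((z + u) / 2 - tau / 8)).

Lemma sqr_oppe2pi : p ^+ 2 = e2pi tau.
Proof. by rewrite sqrrN -hu expr2 -e2piD; congr e2pi; ring. Qed.

Lemma oppe2pi_neq0 : p != 0. Proof. by rewrite oppr_eq0 e2pi_neq0. Qed.

Lemma nm_oppe2pi_lt1 : nm p < 1.
Proof.
have h := q_lt1 htau; rewrite -sqr_oppe2pi nmX in h.
rewrite ltNge; apply/negP => h1.
have : 1 <= nm p ^+ 2 by rewrite exprn_ege1.
by rewrite leNgt h.
Qed.

Hypothesis hx : forall k : int, 1 + X * p * (p ^+ 2) ^ k != 0.

(** With v = X p q^k, g = f / (1 + v) and h = g v, the terms of Phi1 are g and - h at even k, those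
    of Phi2 are h and - g at odd k, for m2 = 0 and 2 respectively. The sum collects g - h; the
    difference collects (-1)^k (g + h) = (-1)^k f, where the denominators are gone. *)
Lemma Phi_sum_diff (z1 z2 : C) : z1 = z + u -> z2 = z - u ->
  let F m := Phi 1 ((m%:R + 1) / 2) (2 * tau) z1 z2 (tau / 8) in
  F 0%N + F 2%N = lam * sumZ (fun k => X ^ k * (p ^+ 2) ^+ tri (k + 1) *
      (1 - X * p * (p ^+ 2) ^ k) / (1 + X * p * (p ^+ 2) ^ k)) /\
  F 0%N - F 2%N = lam * th (p ^+ 2) (- (X * p ^+ 2)).
Proof.
move=> -> -> F.
have X0 : X != 0 by exact: e2pi_neq0.
have p0 := oppe2pi_neq0; have p1 := nm_oppe2pi_lt1.
have q0 := sqr_neq0 p0.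
pose v k := X * p * (p ^+ 2) ^ k.
have v0 k : v k != 0 by exact: mulf_neq0 (mulf_neq0 X0 p0) (expfz_neq0 _ q0).
pose f k := X ^ k * (p ^+ 2) ^+ tri (k + 1).
pose g k := f k / (1 + v k).
pose h k := g k * v k.
have sg : zsummable g := zsummable_lerch p0 p1 X0 hx.
have sf : zsummable f := zsummable_xq p0 p1 X0.
have fgh k : f k = g k + h k.
  have E : g k * (1 + v k) = f k by rewrite /g mulfVK//; exact: hx.
  by rewrite -E mulrDr mulr1.
have sh : zsummable h.
  by apply: zsummable_ext (zsummableD sf (zsummableN sg)) => k; rewrite fgh addrAC subrr add0r.
(* Because e^(4 pi i u) = q, the denominator of Phi2 is 1 + 1/v at the index - 1 - 2j; clearing the
   inverse brings it to the form 1 + v. *)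
have vB j : X^-1 * e2pi u * e2pi tau ^ (2 * j) = - (v (- 1 - 2 * j))^-1.
  rewrite /v -sqr_oppe2pi.
  have h1 : (p ^+ 2) ^ (- 1 - 2 * j) = (p ^+ 2)^-1 * ((p ^+ 2) ^ (2 * j))^-1.
    by rewrite expfzDr// -[(p ^+ 2) ^ (- 1)]/((p ^+ 2)^-1) -invr_expz.
  rewrite h1; have y0 : (p ^+ 2) ^ (2 * j) != 0 by rewrite expfz_neq0.
  move: y0; move: (_ ^ (2 * j)) => y y0; have := p0; rewrite oppr_eq0.
  move: (e2pi u) X X0 => P x x0 P0.
  by field; rewrite P0 x0 y0.
have A1 : Phi1 1 ((0%:R + 1) / 2) (2 * tau) (z + u) (z - u) (tau / 8) =
    lam * sumZ (fun j => g (2 * j)).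
  apply: mul_sumZ_eq; [exact: e2pi_neq0|exact: zsummable_even|move=> j].
  by rewrite mulrA Phi1_num0 Phi1_den -sqr_oppe2pi -mulrA.
have A3 : Phi1 1 ((2%:R + 1) / 2) (2 * tau) (z + u) (z - u) (tau / 8) =
    lam * sumZ (fun j => - h (2 * j)).
  apply: mul_sumZ_eq; [exact: e2pi_neq0|exact: (zsummableN (zsummable_even sh))|move=> j].
  rewrite mulrA Phi1_num2 Phi1_den -sqr_oppe2pi -mulrA; congr (_ * _).
  by rewrite /h /g /v /f mulrN !mulNr mulrN opprK mulrAC.
have frac1 (a V : C) : V != 0 -> 1 + V != 0 -> a / (1 - - V^-1) = a / (1 + V) * V.
  move=> V0 V1; rewrite opprK; have -> : 1 + V^-1 = (1 + V) / V by field.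
  by rewrite invf_div mulrA mulrAC.
have frac2 (a V : C) : V != 0 -> 1 + V != 0 -> a * - V^-1 / (1 - - V^-1) = - (a / (1 + V)).
  move=> V0 V1; rewrite opprK; have -> : 1 + V^-1 = (1 + V) / V by field.
  by rewrite invf_div mulrN mulNr mulrA mulfVK.
have B1 : Phi2 1 ((0%:R + 1) / 2) (2 * tau) (z + u) (z - u) (tau / 8) =
    lam * sumZ (fun j => h (- 1 - 2 * j)).
  apply: mul_sumZ_eq; [exact: e2pi_neq0| |move=> j].
    by apply: zsummable_ext (zsummable_even (zsummable_rev sh)) => j.
  rewrite mulrA Phi2_num0 Phi2_den vB -sqr_oppe2pi -mulrA; congr (_ * _).
  exact: frac1 (v0 _) (hx _).
have B3 : Phi2 1 ((2%:R + 1) / 2) (2 * tau) (z + u) (z - u) (tau / 8) =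
    lam * sumZ (fun j => - g (- 1 - 2 * j)).
  apply: mul_sumZ_eq; [exact: e2pi_neq0| |move=> j].
    by apply: zsummable_ext (zsummableN (zsummable_even (zsummable_rev sg))) => j.
  rewrite mulrA Phi2_num2 Phi2_den vB -sqr_oppe2pi -mulrA; congr (_ * _).
  exact: frac2 (v0 _) (hx _).
have cp (l a b c d : C) : l * a - l * b + (l * c - l * d) = l * (a - b + (c - d)) by ring.
have cm (l a b c d : C) : l * a - l * b - (l * c - l * d) = l * (a - b - (c - d)) by ring.
rewrite /F /Phi A1 A3 B1 B3; split.
  apply: etrans (cp _ _ _ _ _) _; rewrite (parity_sum sg sh); congr (_ * sumZ _).
  apply/funext => k; rewrite /h; apply: etrans (_ : _ = g k * (1 - v k)) _.
    by rewrite mulrBr mulr1.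
  by rewrite /g mulrAC.
apply: etrans (cm _ _ _ _ _) _; rewrite (parity_diff sg sh sf fgh); congr (_ * sumZ _).
apply/funext => k; rewrite /f.
have -> : (p ^+ 2) ^+ tri (k + 1) = (p ^+ 2) ^ k * (p ^+ 2) ^+ tri k.
  rewrite !exprnP -expfzDr//; congr (_ ^ _).
  by rewrite triD (_ : tri 1 = 0%N)//; lia.
have -> : (- (X * p ^+ 2)) ^ k = (- 1) ^ k * (X ^ k * (p ^+ 2) ^ k).
  have E : - (X * p ^+ 2) = - 1 * (X * p ^+ 2) by rewrite mulN1r.
  have uN : (- 1 : C) \is a GRing.unit by rewrite unitfE oppr_eq0 oner_eq0.
  have uX : X \is a GRing.unit by rewrite unitfE.
  have uq : p ^+ 2 \is a GRing.unit by rewrite unitfE.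
  have uY : X * p ^+ 2 \is a GRing.unit by rewrite unitrM uX uq.
  rewrite E (exprzMl k uN uY) (exprzMl k uX uq); reflexivity.
have assoc (a b c d : C) : a * (b * (c * d)) = a * (b * c) * d by rewrite !mulrA.
exact: assoc.
Qed.

End PhiLerch.

Section Algebra.
Variable F : fieldType.

(** Here [l] is the common exponential, [S] the Lerch sum, [T] the series of theta_11, [A] and [B]
    are theta_01 and theta_00, [E] and [Ep] are (q; q) and (p; p), and [e], [h], [d] are eta at tau,
    tau/2, 2 tau. The core identity eliminates [S], the eta relation [Ep]. *)
Lemma minus_alg (F0 F2 l S T A B E Ep e h d I : F) :
  (2 : F) != 0 -> l != 0 -> T != 0 -> A != 0 -> E != 0 -> e != 0 -> h != 0 -> d != 0 ->
  I * I = - 1 -> F0 + F2 = l * S -> F0 - F2 = l * T ->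
  A * E * S = Ep ^+ 2 * (B * T) -> Ep ^+ 2 * h ^+ 2 * d ^+ 2 = E * e ^+ 5 ->
  F0 / (e ^+ 3 / h * (I * l * T / A)) =
    - (I / 2) * (e ^+ 2 / (h * d ^+ 2) * B + h / e ^+ 3 * A) /\
  F2 / (e ^+ 3 / h * (I * l * T / A)) =
    - (I / 2) * (e ^+ 2 / (h * d ^+ 2) * B - h / e ^+ 3 * A).
Proof.
move=> n2 l0 T0 A0 E0 e0 h0 d0 II hp hm hc he.
have I0 : I != 0.
  by apply/eqP => I0; move/eqP: II; rewrite I0 mul0r eq_sym oppr_eq0 oner_eq0.
have IV : I^-1 = - I by apply: (mulfI I0); rewrite mulfV// mulrN II opprK.
have hE : Ep ^+ 2 = E * e ^+ 5 / (h ^+ 2 * d ^+ 2).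
  by rewrite -he; field; rewrite h0 d0.
have hS : S = e ^+ 5 / (h ^+ 2 * d ^+ 2) * (B * T) / A.
  apply: (mulfI (mulf_neq0 A0 E0)); rewrite hc hE; field.
  by rewrite A0 h0 d0.
have -> : F0 = l * (S + T) / 2.
  by rewrite mulrDr -hp -hm; field.
have -> : F2 = l * (S - T) / 2.
  by rewrite mulrBr -hp -hm; field.
have hI : - (I / 2) = I^-1 / 2 by rewrite IV mulNr.
rewrite hS hI; split; field; by rewrite ?n2 ?I0 ?l0 ?T0 ?A0 ?e0 ?h0 ?d0.
Qed.

(** As p now has the opposite sign, [A] is theta_00 and [B] is theta_01. *)
Lemma plus_alg (F0 F2 l S T A B E Ep e h d : F) :
  (2 : F) != 0 -> l != 0 -> T != 0 -> A != 0 -> E != 0 -> e != 0 -> h != 0 -> d != 0 ->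
  F0 + F2 = l * S -> F0 - F2 = l * T ->
  A * E * S = Ep ^+ 2 * (B * T) -> Ep ^+ 2 * e = E * h ^+ 2 ->
  F0 / (h * d * (- l * T / A)) =
    - (1 / 2) * (h / (d * e) * B + 1 / (h * d) * A) /\
  F2 / (h * d * (- l * T / A)) =
    - (1 / 2) * (h / (d * e) * B - 1 / (h * d) * A).
Proof.
move=> n2 l0 T0 A0 E0 e0 h0 d0 hp hm hc he.
have hE : Ep ^+ 2 = E * h ^+ 2 / e by rewrite -he; field.
have hS : S = h ^+ 2 / e * (B * T) / A.
  apply: (mulfI (mulf_neq0 A0 E0)); rewrite hc hE; field.
  by rewrite A0 e0.
have -> : F0 = l * (S + T) / 2.
  by rewrite mulrDr -hp -hm; field.
have -> : F2 = l * (S - T) / 2.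
  by rewrite mulrBr -hp -hm; field.
rewrite hS; split; field; by rewrite ?n2 ?l0 ?T0 ?A0 ?e0 ?h0 ?d0 ?oppr_eq0 ?oner_eq0.
Qed.

End Algebra.

(** * Continuity of theta series and isolation of the exceptional points *)

Section Limits.
Variable R : realType.
Local Notation C := (Cplx R).

Lemma cvg_exprz {T} {F : set_system T} {FF : Filter F} (y : T -> C) (l : C) (k : int) :
  l != 0 -> y t @[t --> F] --> l -> y t ^ k @[t --> F] --> l ^ k.
Proof.
move=> l0 cy.
have P (n : nat) : y t ^+ n @[t --> F] --> l ^+ n.
  elim: n => [|n IH]; first exact: cvg_cst.
  by rewrite exprS; under eq_fun do rewrite exprS; exact: (cvgM cy IH).
case: k => n; first exact: P.
apply: cvgV; last exact: P.
by rewrite expf_neq0.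
Qed.

Lemma cvg_th {T} {F : set_system T} {FF : Filter F} (q : C) (y : T -> C) (l : C) :
  q != 0 -> nm q < 1 -> l != 0 -> y t @[t --> F] --> l ->
  th q (y t) @[t --> F] --> th q l.
Proof.
move=> q0 q1 l0 cy.
have nl0 : 0 < nm l by rewrite nm_gt0.
have nlV : 0 < (nm l)^-1 by rewrite invr_gt0.
(* Near the limit both |y| and 1/|y| exceed their limits by at most 1. *)
pose B := nm l + (nm l)^-1 + 2.
have B0 : 0 <= B by rewrite /B; lra.
have h0 : 0 < (2^-1 : R) by lra.
have nq0 : 0 < nm q by rewrite nm_gt0.
have [A A0 hA] := tri_dom nq0 q1 B0 h0.
have bd (x : C) k : x != 0 -> nm x + (nm x)^-1 <= B ->
    nm (x ^ k * q ^+ tri k) <= A * 2^-1 ^+ `|k|%N.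
  move=> x0 xB; apply: le_trans (hA k); rewrite nmM nmX mulrC.
  rewrite ler_wpM2l ?exprn_ge0 ?nm_ge0//; apply: le_trans (nm_exprz k x0) _.
  by rewrite lerXn2r// nnegrE addr_ge0 ?invr_ge0 ?nm_ge0.
have cV : (y t)^-1 @[t --> F] --> l^-1 by exact: cvgV.
have h1 : 0 < (1 : R) by lra.
have h2 : 0 < nm l / 2 by lra.
apply: (@tannery _ _ _ _ (fun t n => y t ^ n * q ^+ tri n) (fun n => l ^ n * q ^+ tri n) A 2^-1).
- lra.
- lra.
- near=> t => k.
  have e1 : nm (y t - l) <= 1 by near: t; exact: (nm_cvg cy h1).
  have e2 : nm ((y t)^-1 - l^-1) <= 1 by near: t; exact: (nm_cvg cV h1).
  have e3 : nm (y t - l) <= nm l / 2 by near: t; exact: (nm_cvg cy h2).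
  apply: bd.
    rewrite -nm_gt0; have := nmD (- (y t - l)) (y t); rewrite nmN opprB subrK; lra.
  have := nmD (y t - l) l; have := nmD ((y t)^-1 - l^-1) l^-1.
  by rewrite !subrK !nmV /B; lra.
- by move=> k; apply: (bd l k l0); rewrite /B; lra.
- by move=> k; exact: cvgM (cvg_exprz l0 cy) (cvg_cst _).
Unshelve. all: by end_near. Qed.

Lemma near_nm (z : C) (e : R) : 0 < e -> \forall w \near z, nm (w - z) <= e.
Proof.
move=> e0; have h : (fun w : C => w) @ z --> z by exact: cvg_id.
exact: (@nm_cvg R C (nbhs z) (nbhs_filter z) (fun w => w) z h e e0).
Qed.

(* Two distinct points w with e^(4 pi i w) in q^Z are at distance at least
   min(1, Im tau) / 2. *)
Lemma near_good (tau z : C) : 0 < complex.Im tau ->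
  \forall w \near z^', forall m : int, e2pi w ^+ 2 * e2pi tau ^ m != 1.
Proof.
move=> htau.
pose bad (w : C) := exists m : int, e2pi w ^+ 2 * e2pi tau ^ m = 1.
(* Two points within r of z differ by less than 1/4, and their imaginary parts by less than Im tau /
   4. *)
pose r : R := Num.min (8^-1) (complex.Im tau / 8).
have r0 : 0 < r by rewrite lt_min; apply/andP; split; lra.
have r8 : r <= 8^-1 by rewrite /r ge_min lexx.
have rt : r <= complex.Im tau / 8 by rewrite /r ge_min lexx orbT.
have E (w : C) m : e2pi w ^+ 2 * e2pi tau ^ m = e2pi (2 * w + m%:~R * tau).
  by rewrite -e2pi_mulz expr2 -!e2piD; congr e2pi; ring.
have Im2 (w : C) (m : int) : complex.Im (2 * w + m%:~R * tau) =
    2 * complex.Im w + m%:~R * complex.Im tau.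
  have -> : (2 : C) = 2%:C by rewrite rmorph_nat.
  have -> : (m%:~R : C) = (m%:~R)%:C by rewrite rmorph_int.
  by move: (tau); case: w => [a b] [c d] /=; ring.
have badIm (w : C) m : e2pi w ^+ 2 * e2pi tau ^ m = 1 ->
    2 * complex.Im w + m%:~R * complex.Im tau = 0.
  rewrite E => /(congr1 (@nm R)); rewrite nm_e2pi nm1 Im2 => h.
  move: (etrans h (esym (@expR0 R))) => /expR_inj/eqP.
  rewrite oppr_eq0 !mulf_eq0 pnatr_eq0 /= gt_eqF ?pi_gt0//= => /eqP.
  by [].
have uniq w w' : nm (w - z) < r -> nm (w' - z) < r -> bad w -> bad w' -> w = w'.
  move=> wz wz' [m hm] [m' hm'].
  have d : nm (w - w') < 4^-1.
    have := nmD (w - z) (- (w' - z)); rewrite nmN.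
    have -> : w - z - (w' - z) = w - w' by ring.
    lra.
  have dI : `|complex.Im w - complex.Im w'| < complex.Im tau / 4.
    rewrite -ImB; apply: le_lt_trans (nm_Im _) _.
    have := nmD (w - z) (- (w' - z)); rewrite nmN.
    have -> : w - z - (w' - z) = w - w' by ring.
    lra.
  have i1 := badIm _ _ hm; have i2 := badIm _ _ hm'.
  (* Moduli give (m - m') Im tau = - 2 (Im w - Im w'), of absolute value below Im tau / 2. *)
  have mm : m = m'.
    apply/eqP; rewrite -subr_eq0; apply/negPn/negP => mn.
    have : 1 <= `|(m - m')%:~R : R|.
      by rewrite -intr_norm -[1]/(1%:~R) ler_int; lia.
    have : (m - m')%:~R * complex.Im tau = - 2 * (complex.Im w - complex.Im w').
      by rewrite intrB mulrBl; lra.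
    move=> /(congr1 Num.norm); rewrite !normrM normrN (ger0_norm (ltW htau)).
    rewrite (@ger0_norm _ 2)//; nra.
  have wI : complex.Im (w - w') = 0 by rewrite ImB; move: i1 i2; rewrite mm; lra.
  have E1 : e2pi (2 * (w - w')) = 1.
    have -> : 2 * (w - w') = 2 * w + m%:~R * tau - (2 * w' + m'%:~R * tau).
      by rewrite mm; ring.
    by rewrite e2piD e2piN -!E hm hm' invr1 mulr1.
  have two : (2 : C) = 2%:C by rewrite rmorph_nat.
  have D0 : 2 * (w - w') = 0.
    apply: e2pi_eq1 => //.
      by rewrite two; case: (w - w') wI => a b /= ->; ring.
    have := nm_Re (w - w'); have : nm (w - w') < 4^-1 by [].
    rewrite two; case: (w - w') => a b /= h1 h2.
    rewrite mul0r subr0 normrM ger0_norm//; lra.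
  move/eqP: D0; rewrite mulf_eq0 subr_eq0 pnatr_eq0 /= => /eqP.
  by [].
(* At most one bad point other than z lies within r; the radius is cut below its distance. *)
have [s s0 hs] : exists2 s, 0 < s & forall w, nm (w - z) < s -> w != z -> ~ bad w.
  case: (pselect (exists w0, [/\ nm (w0 - z) < r, w0 != z & bad w0])) => [[w0 [h1 h2 h3]]|no].
    exists (Num.min r (nm (w0 - z))).
      by rewrite lt_min r0 nm_gt0 subr_eq0.
    move=> w; rewrite lt_min => /andP[w1 w2] wz bw.
    by move: w2; rewrite (uniq _ _ w1 h1 bw h3) ltxx.
  by exists r => // w w1 wz bw; apply: no; exists w.
have s20 : 0 < s / 2 by lra.
have n1 : z^' (fun w => nm (w - z) <= s / 2) := nbhs_dnbhs (near_nm z s20).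
have n2 : z^' (fun w => w != z) := nbhs_dnbhs_neq z.
apply: (@filterS2 _ z^' (dnbhs_filter z) _ _ _ _ n1 n2) => w h1 h2 m.
by apply/eqP => hm; apply: (hs w) => //; [lra|exists m].
Qed.

Lemma lim_near_eq {T} {F : set_system T} {FF : ProperFilter F} (f g : T -> C) (l : C) :
  (\forall t \near F, f t = g t) -> g t @[t --> F] --> l -> lim (f t @[t --> F]) = l.
Proof.
move=> fg cg; apply: norm_cvg_lim; apply: cvg_nm => e e0.
by apply: filterS2 (nm_cvg cg e0) fg => t h ->.
Qed.

End Limits.

Section Characters.
Variables (R : realType) (tau : Cplx R).
Local Notation C := (Cplx R).
Hypothesis htau : 0 < complex.Im tau.
Local Notation q := (e2pi tau).

Lemma Im_half : 0 < complex.Im (tau / 2 : C).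
Proof.
have -> : tau / 2 = tau * (2^-1)%:C by rewrite fmorphV rmorph_nat.
move: htau; case: tau => a b /= b0; rewrite mulr0 add0r divr_gt0//.
Qed.

Lemma Im_double : 0 < complex.Im (2 * tau : C).
Proof.
have -> : 2 * tau = 2%:C * tau :> C by rewrite rmorph_nat.
move: htau; case: tau => a b /= b0; rewrite mul0r addr0 mulr_gt0//.
Qed.

Lemma eta_neq0 (t : C) : 0 < complex.Im t -> eta t != 0.
Proof.
move=> ht; rewrite etaE; apply: mulf_neq0; first exact: e2pi_neq0.
exact: (Pochq_neq0 (e2pi_neq0 t) (q_lt1 ht)).
Qed.

Lemma half_sqr : e2pi (tau / 2) ^+ 2 = q.
Proof. by rewrite expr2 -e2piD; congr e2pi; field. Qed.

(** Squaring turns X p q^k = -1 into X^2 q^(2k+1) = 1 and X q^(k+1) = 1 into X^2 q^(2k+2) = 1. A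
    single condition on X^2 thus excludes the poles and the zeros of theta_11, for either sign of
    p. *)
Lemma good_poles (p X : C) : p != 0 ->
  (forall m : int, X ^+ 2 * (p ^+ 2) ^ m != 1) ->
  (forall k : int, 1 + X * p * (p ^+ 2) ^ k != 0) /\
  (forall k : int, 1 + - (X * p ^+ 2) * (p ^+ 2) ^ k != 0).
Proof.
move=> p0 H; have q0 := sqr_neq0 p0.
split=> k; apply/eqP => h.
- move/eqP: (H (k + k + 1)); apply; rewrite !expfzDr// expr1z.
  have : X * p * (p ^+ 2) ^ k = - 1 by move/eqP: h; rewrite addrC addr_eq0 => /eqP.
  move: (_ ^ k) => y hy; transitivity ((X * p * y) ^+ 2); first ring.
  by rewrite hy sqrrN expr1n.
- move/eqP: (H (k + k + (1 + 1))); apply; rewrite !expfzDr// expr1z.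
  have : X * p ^+ 2 * (p ^+ 2) ^ k = 1.
    by move/eqP: h; rewrite mulNr subr_eq0 eq_sym => /eqP.
  move: (_ ^ k) => y hy; transitivity ((X * p ^+ 2 * y) ^+ 2); first ring.
  by rewrite hy expr1n.
Qed.

Section Values.
Variables (u w : C).
Hypothesis hu : e2pi (2 * u) = q.
Hypothesis good : forall m : int, e2pi w ^+ 2 * q ^ m != 1.
Local Notation p := (- e2pi u).
Local Notation X := (e2pi w).
Local Notation lam := (e2pi ((w + u) / 2 - tau / 8)).

Lemma Phi_values :
  let F m := Phi 1 ((m%:R + 1) / 2) (2 * tau) (w + u) (w - u) (tau / 8) in
  exists S, [/\ F 0%N + F 2%N = lam * S,
    F 0%N - F 2%N = lam * th q (- (X * q)),
    th q (X * p) * Poch q q * S =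
      Poch p p ^+ 2 * (th q (- (X * p)) * th q (- (X * q))),
    th q (X * p) != 0 & th q (- (X * q)) != 0].
Proof.
move=> F; have p0 := @oppe2pi_neq0 R u; have p1 := nm_oppe2pi_lt1 htau hu.
have hq := sqr_oppe2pi hu; have X0 : X != 0 := e2pi_neq0 w.
have q0 : q != 0 := e2pi_neq0 tau; have q1 := q_lt1 htau.
have good' : forall m : int, X ^+ 2 * (p ^+ 2) ^ m != 1 by rewrite hq.
have [h1 h2] := good_poles p0 good'.
have [d1 d2] := Phi_sum_diff htau hu h1 (erefl (w + u)) (erefl (w - u)).
have cid := core_identity p0 p1 X0 h1.
have t1 : th (p ^+ 2) (X * p) != 0.
  by apply: th_neq0 h1; [exact: sqr_neq0|exact: sqr_lt1|exact: mulf_neq0].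
have t2 : th (p ^+ 2) (- (X * p ^+ 2)) != 0.
  apply: th_neq0 h2; [exact: sqr_neq0|exact: sqr_lt1|].
  by rewrite oppr_eq0; exact: (mulf_neq0 X0 (sqr_neq0 p0)).
rewrite hq in d1 d2 cid t1 t2.
eexists; split; [exact: d1|exact: d2|exact: cid|exact: t1|exact: t2].
Qed.

End Values.

Lemma theta11_th w : theta 1 1 tau w =
  e2pi (tau / 8 + w / 2 + 4^-1) * th q (- (e2pi w * q)).
Proof.
apply: theta11E.
have y0 : - (e2pi w * q) != 0.
  by rewrite oppr_eq0; exact: (mulf_neq0 (e2pi_neq0 w) (e2pi_neq0 tau)).
have h0 : 0 < (2^-1 : R) by lra.
have [A A0 hA] := theta_dom y0 (e2pi_neq0 tau) (q_lt1 htau) h0.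
by exists A, 2^-1; split; [lra|lra|].
Qed.

Lemma minus_values w : (forall m : int, e2pi w ^+ 2 * q ^ m != 1) ->
  Phi 1 ((0%:R + 1) / 2) (2 * tau) (w + tau / 2) (w - tau / 2) (tau / 8) / Rminus tau w =
     - ('i / 2) * (eta tau ^+ 2 / (eta (tau / 2) * eta (2 * tau) ^+ 2)
                     * theta 0 0 tau w
                   + eta (tau / 2) / eta tau ^+ 3 * theta 0 1 tau w) /\
  Phi 1 ((2%:R + 1) / 2) (2 * tau) (w + tau / 2) (w - tau / 2) (tau / 8) / Rminus tau w =
     - ('i / 2) * (eta tau ^+ 2 / (eta (tau / 2) * eta (2 * tau) ^+ 2)
                     * theta 0 0 tau w
                   - eta (tau / 2) / eta tau ^+ 3 * theta 0 1 tau w).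
Proof.
move=> good.
have hu : e2pi (2 * (tau / 2)) = q by congr e2pi; field.
have [S [d1 d2 d3 t1 t2]] := Phi_values hu good.
have e1 : theta 0 1 tau w = th q (e2pi w * - e2pi (tau / 2)) by rewrite theta01E mulrN.
have e2 : theta 0 0 tau w = th q (- (e2pi w * - e2pi (tau / 2))).
  by rewrite (mulrN (e2pi w) (e2pi (tau / 2))) opprK; exact: theta00E.
have e3 : theta 1 1 tau w =
    'i * e2pi ((w + tau / 2) / 2 - tau / 8) * th q (- (e2pi w * q)).
  have E : tau / 8 + w / 2 + 4^-1 = 4^-1 + ((w + tau / 2) / 2 - tau / 8) by field.
  rewrite theta11_th E (e2piD 4^-1) e2pi_quarter; reflexivity.
have E0 : Poch q q != 0 := Pochq_neq0 (e2pi_neq0 tau) (q_lt1 htau).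
have n2 : (2 : C) != 0 by rewrite pnatr_eq0.
have II : 'i * 'i = - 1 :> C by rewrite -expr2 sqr_i.
(* The square of [Poch_eta]; the prefactors of the eta functions are powers of q^(1/48), and both
   sides carry its tenth power. *)
have he : Poch (- e2pi (tau / 2)) (- e2pi (tau / 2)) ^+ 2 * eta (tau / 2) ^+ 2 *
    eta (2 * tau) ^+ 2 = Poch q q * eta tau ^+ 5.
  have x0 : - e2pi (tau / 2) != 0 by rewrite oppr_eq0 e2pi_neq0.
  have x1 : nm (- e2pi (tau / 2)) < 1 by rewrite nmN; exact: (q_lt1 Im_half).
  have := Poch_eta x0 x1.
  have -> : (- e2pi (tau / 2)) ^+ 4 = e2pi (2 * tau).
    rewrite (exprM _ 2 2) sqrrN half_sqr expr2 -e2piD; congr e2pi; ring.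
  rewrite opprK sqrrN half_sqr !etaE.
  have -> : e2pi (tau / 24) = e2pi (tau / 48) ^+ 2.
    by rewrite expr2 -e2piD; congr e2pi; field.
  have -> : e2pi (2 * tau / 24) = e2pi (tau / 48) ^+ 4.
    by rewrite (exprM _ 2 2) !expr2 -!e2piD; congr e2pi; field.
  have -> : tau / 2 / 24 = tau / 48 by field.
  move: (e2pi (tau / 48)) (Poch _ _) (Poch _ _) (Poch _ _) (Poch _ _) => t d c b a h.
  by transitivity (t ^+ 10 * (a * b * c) ^+ 2); [ring|rewrite h; ring].
rewrite /Rminus e1 e2 e3.
exact: (minus_alg n2 (e2pi_neq0 _) t2 t1 E0 (eta_neq0 htau) (eta_neq0 Im_half)
  (eta_neq0 Im_double) II d1 d2 d3 he).
Qed.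

Lemma plus_values w : (forall m : int, e2pi w ^+ 2 * q ^ m != 1) ->
  Phi 1 ((0%:R + 1) / 2) (2 * tau) (w + tau / 2 - 1 / 2) (w - tau / 2 + 1 / 2)
    (tau / 8) / Rplus tau w =
     - (1 / 2) * (eta (tau / 2) / (eta (2 * tau) * eta tau) * theta 0 1 tau w
                  + 1 / (eta (tau / 2) * eta (2 * tau)) * theta 0 0 tau w) /\
  Phi 1 ((2%:R + 1) / 2) (2 * tau) (w + tau / 2 - 1 / 2) (w - tau / 2 + 1 / 2)
    (tau / 8) / Rplus tau w =
     - (1 / 2) * (eta (tau / 2) / (eta (2 * tau) * eta tau) * theta 0 1 tau w
                  - 1 / (eta (tau / 2) * eta (2 * tau)) * theta 0 0 tau w).
Proof.
move=> good.
have -> : w + tau / 2 - 1 / 2 = w + (tau / 2 - 1 / 2) by ring.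
have -> : w - tau / 2 + 1 / 2 = w - (tau / 2 - 1 / 2) by ring.
have hu : e2pi (2 * (tau / 2 - 1 / 2)) = q.
  have -> : 2 * (tau / 2 - 1 / 2) = tau - 1 by field.
  by rewrite e2piD e2piN e2pi1 invr1 mulr1.
have [S [d1 d2 d3 t1 t2]] := Phi_values hu good.
have hp : - e2pi (tau / 2 - 1 / 2) = e2pi (tau / 2).
  have -> : (1 / 2 : C) = 2^-1 by rewrite mul1r.
  by rewrite e2piD e2piN e2pi_half invrN1 mulrN1 opprK.
rewrite hp in d3 t1.
have e1 := theta01E tau w.
have e2 := theta00E tau w.
have e3 : theta 1 1 tau w =
    - e2pi ((w + (tau / 2 - 1 / 2)) / 2 - tau / 8) * th q (- (e2pi w * q)).
  (* The half period in u contributes - 1/4 to the exponent of the common factor, so the constant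
     1/4 becomes 1/2, and the i of the supercharacters becomes -1. *)
  have E : tau / 8 + w / 2 + 4^-1 =
      2^-1 + ((w + (tau / 2 - 1 / 2)) / 2 - tau / 8) by field.
  rewrite theta11_th E (e2piD 2^-1) e2pi_half mulN1r; reflexivity.
have E0 : Poch q q != 0 := Pochq_neq0 (e2pi_neq0 tau) (q_lt1 htau).
have n2 : (2 : C) != 0 by rewrite pnatr_eq0.
have he : Poch (e2pi (tau / 2)) (e2pi (tau / 2)) ^+ 2 * eta tau =
    Poch q q * eta (tau / 2) ^+ 2.
  rewrite !etaE.
  have -> : e2pi (tau / 24) = e2pi (tau / 48) ^+ 2.
    by rewrite expr2 -e2piD; congr e2pi; field.
  have -> : tau / 2 / 24 = tau / 48 by field.
  by move: (e2pi (tau / 48)) (Poch _ _) (Poch _ _) => t a b; ring.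
rewrite /Rplus e1 e2 e3.
exact: (plus_alg n2 (e2pi_neq0 _) t2 t1 E0 (eta_neq0 htau) (eta_neq0 Im_half)
  (eta_neq0 Im_double) d1 d2 d3 he).
Qed.

Lemma cvg_theta0 (b : bool) {F : set_system C} {FF : Filter F} (z : C) :
  (fun w : C => w) @ F --> z -> theta 0 b tau w @[w --> F] --> theta 0 b tau z.
Proof.
move=> cz; have cX := cvg_e2pi cz.
have q0 := e2pi_neq0 tau; have q1 := q_lt1 htau.
have cy : e2pi w * e2pi (tau / 2) @[w --> F] --> e2pi z * e2pi (tau / 2).
  by apply: cvgM; [exact: cX|exact: cvg_cst].
have y0 : e2pi z * e2pi (tau / 2) != 0.
  exact: (mulf_neq0 (e2pi_neq0 z) (e2pi_neq0 _)).
case: b => /=.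
  rewrite theta01E; under eq_fun do rewrite theta01E.
  have yn0 : - (e2pi z * e2pi (tau / 2)) != 0 by rewrite oppr_eq0.
  exact: (cvg_th q0 q1 yn0 (cvgN cy)).
rewrite theta00E; under eq_fun do rewrite theta00E.
exact: (cvg_th q0 q1 y0 cy).
Qed.

Lemma cvg_theta_comb (c a b : C) {F : set_system C} {FF : Filter F} (z : C) :
  (fun w : C => w) @ F --> z ->
  (c * (a * theta 0 0 tau w + b * theta 0 1 tau w) @[w --> F] -->
     c * (a * theta 0 0 tau z + b * theta 0 1 tau z)).
Proof.
move=> cz; have h0 := @cvg_theta0 false F FF z cz; have h1 := @cvg_theta0 true F FF z cz.
apply: cvgM; first exact: cvg_cst.
by apply: cvgD; (apply: cvgM; first exact: cvg_cst); [exact: h0|exact: h1].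
Qed.

Lemma cvg_id_dnbhs (z : C) : (fun w : C => w) @ z^' --> z.
Proof. exact: cvg_within. Qed.

(** The formula holds on a punctured neighbourhood by [near_good], and its right side is continuous
    at z. *)
Lemma lim_dnbhs_theta (z c a b : C) (f : C -> C) :
  (forall w, (forall m : int, e2pi w ^+ 2 * q ^ m != 1) ->
     f w = c * (a * theta 0 0 tau w + b * theta 0 1 tau w)) ->
  lim (f w @[w --> z^']) = c * (a * theta 0 0 tau z + b * theta 0 1 tau z).
Proof.
move=> H.
apply: (@lim_near_eq R C (z^') (Proper_dnbhs_numFieldType z) f _ _ _
  (@cvg_theta_comb c a b (z^') (dnbhs_filter z) z (@cvg_id_dnbhs z))).
exact: (@filterS _ (z^') (dnbhs_filter z) _ _ H (near_good z htau)).
Qed.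

End Characters.

Theorem theorem6p1 (R : realType) (tau z : Cplx R)
    (htau : 0 < complex.Im tau) :
  (ch_plus 0 tau z =
     - (1 / 2) * (eta (tau / 2) / (eta (2 * tau) * eta tau) * theta 0 1 tau z
                  + 1 / (eta (tau / 2) * eta (2 * tau)) * theta 0 0 tau z)
   /\
   ch_plus 2 tau z =
     - (1 / 2) * (eta (tau / 2) / (eta (2 * tau) * eta tau) * theta 0 1 tau z
                  - 1 / (eta (tau / 2) * eta (2 * tau)) * theta 0 0 tau z))
  /\
  (ch_minus 0 tau z =
     - ('i / 2) * (eta tau ^+ 2 / (eta (tau / 2) * eta (2 * tau) ^+ 2)
                     * theta 0 0 tau z
                   + eta (tau / 2) / eta tau ^+ 3 * theta 0 1 tau z)
   /\
   ch_minus 2 tau z =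
     - ('i / 2) * (eta tau ^+ 2 / (eta (tau / 2) * eta (2 * tau) ^+ 2)
                     * theta 0 0 tau z
                   - eta (tau / 2) / eta tau ^+ 3 * theta 0 1 tau z)).
Proof.
have swap (a b s t : Cplx R) : a * s + b * t = b * t + a * s by rewrite addrC.
have swapB (a b s t : Cplx R) : a * s - b * t = - b * t + a * s by rewrite addrC mulNr.
have mulB (a b s t : Cplx R) : a * s - b * t = a * s + - b * t by rewrite mulNr.
split; split.
- rewrite swap; apply: (lim_dnbhs_theta htau) => w good.
  by rewrite -swap; exact: (plus_values htau good).1.
- rewrite swapB; apply: (lim_dnbhs_theta htau) => w good.
  by rewrite -swapB; exact: (plus_values htau good).2.
- by apply: (lim_dnbhs_theta htau) => w good; exact: (minus_values htau good).1.
- rewrite mulB; apply: (lim_dnbhs_theta htau) => w good.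
  by rewrite -mulB; exact: (minus_values htau good).2.
Qed.
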